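(* Let $\Omega\subset\mathbb{R}^n$ be open and bounded, let $\mathbb{T}^n=(\mathbb{R}/2\pi\mathbb{Z})^n$, let $\omega:\Omega\to\mathbb{R}^n$ be the frequency map $\omega=\nabla_I h$ of an integrable Hamiltonian $H(I,\theta)=h(I)$ on $\Omega\times\mathbb{T}^n$, and let $\mathcal{F}(I,\theta)=(I,\theta+\omega(I))$. Suppose $G\in C_b(\Omega\times\mathbb{T}^n)$ is continuous and bounded, that the initial values of $\mathcal{F}$ are distributed with probability density $\rho_0\in L^2(\Omega\times\mathbb{T}^n)$, and that $\omega$ satisfies the nonresonance condition $$\langle k,\omega(I)\rangle\neq 2m\pi\qquad\text{for all } k\in\mathbb{Z}^n\setminus\{0\},\ m\in\mathbb{Z},\ I\in\Omega .$$ Then $$\lim_{N\to\infty}\frac1N\sum_{j=1}^N\langle G\rangle_j=\langle\bar G(I)\rangle_0,$$ where $\displaystyle\bar G(I)=\frac{1}{(2\pi)^n}\int_{\mathbb{T}^n}G(I,\theta)\,d\theta$.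
   Context: For $j\ge 0$, $\mathcal{F}^j(I,\theta)=(I,\theta+j\omega(I))$ and, for an observable $G$ (possibly complex-valued), $\langle G\rangle_j=\int_{\Omega\times\mathbb{T}^n}G(\mathcal{F}^j(I,\theta))\,\rho_0(I,\theta)\,dI\,d\theta$. In particular $\langle\bar G(I)\rangle_0=\int_{\Omega\times\mathbb{T}^n}\bar G(I)\,\rho_0(I,\theta)\,dI\,d\theta$. $C_b$ denotes bounded continuous functions. A probability density is a nonnegative function with integral $1$ with respect to Lebesgue measure $dI\,d\theta$ (total mass of $\mathbb{T}^n$ being $(2\pi)^n$). *)

(* Defs.v *)
From HB Require Import structures.
From mathcomp Require Import all_boot all_order all_algebra.
From mathcomp Require Import generic_quotient.
From mathcomp Require ring_quotient.
From mathcomp Require Import complex.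
From mathcomp Require Import all_classical all_reals all_analysis.

Set Implicit Arguments.
Unset Strict Implicit.
Unset Printing Implicit Defensive.

Import Order.TTheory GRing.Theory Num.Theory.
Import numFieldNormedType.Exports.

Local Open Scope classical_set_scope.
Local Open Scope ring_scope.
Local Open Scope complex_scope.

Definition measure_row_display : measure_display -> measure_display.
Proof. exact. Qed.

Section measurable_row.
Context {d} {T : measurableType d}.
Variable n : nat.

Let coord : 'I_n -> 'rV[T]_n -> T := fun i v => v ord0 i.

Let row_set0 : g_sigma_preimage coord set0.
Proof. exact: sigma_algebra0. Qed.

Let row_setC A : g_sigma_preimage coord A -> g_sigma_preimage coord (~` A).
Proof. exact: sigma_algebraC. Qed.

Let row_bigcup (F : (set 'rV[T]_n)^nat) :
  (forall i, g_sigma_preimage coord (F i)) ->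
  g_sigma_preimage coord (\bigcup_i (F i)).
Proof. exact: sigma_algebra_bigcup. Qed.

(* The product sigma-algebra, generated by the coordinate maps. *)
HB.instance Definition _ := @isMeasurable.Build (measure_row_display d)
  'rV[T]_n (g_sigma_preimage coord) row_set0 row_setC row_bigcup.

Lemma measurable_coord (i : 'I_n) :
  measurable_fun [set: 'rV[T]_n] (fun v : 'rV[T]_n => v ord0 i).
Proof.
move=> _ A mA; rewrite setTI; apply: sub_sigma_algebra => /=.
rewrite -bigcup_seq/=; exists i => /=; first by rewrite mem_index_enum.
by exists A => //; rewrite setTI.
Qed.

Lemma measurable_fun_row d' (T' : measurableType d') (f : T' -> 'rV[T]_n) :
  (forall i, measurable_fun setT (fun x => f x ord0 i)) ->
  measurable_fun setT f.
Proof.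
move=> mf _ A mA.
have : g_sigma_preimage (fun i x => f x ord0 i) (f @^-1` A).
  by rewrite (g_sigma_preimage_comp coord f); exists A => //; rewrite setTI.
suff : g_sigma_preimage (fun i x => f x ord0 i) `<=` measurable.
  by rewrite setTI; exact.
apply: smallest_sub; first exact: sigma_algebra_measurable.
by rewrite -bigcup_seq => B [i _ [C mC <-]]; exact: mf.
Qed.

End measurable_row.

Section power_measure.
Context {d} {T : measurableType d} {R : realType}.

Definition row_cons n (p : T * 'rV[T]_n) : 'rV[T]_n.+1 :=
  row_mx (const_mx p.1 : 'rV_1) p.2.

Definition row_uncons n (v : 'rV[T]_n.+1) : T * 'rV[T]_n :=
  (v ord0 ord0, @rsubmx T 1 1 n v).

Lemma row_cons0 n (p : T * 'rV[T]_n) : row_cons p ord0 ord0 = p.1.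
Proof.
transitivity (row_cons p ord0 (lshift n (ord0 : 'I_1))).
  by congr fun_of_matrix; exact: ord_inj.
by apply: etrans (row_mxEl _ _ _ _) _; rewrite mxE.
Qed.

Lemma row_consS n (p : T * 'rV[T]_n) (j : 'I_n) :
  row_cons p ord0 (lift ord0 j) = p.2 ord0 j.
Proof.
transitivity (row_cons p ord0 (rshift 1 j)); last exact: row_mxEr.
by congr fun_of_matrix; exact: ord_inj.
Qed.

Lemma row_consK n : cancel (@row_cons n) (@row_uncons n).
Proof.
move=> [x v]; rewrite /row_uncons; congr pair; last exact: row_mxKr.
exact: row_cons0.
Qed.

Lemma measurable_row_cons n : measurable_fun setT (@row_cons n).
Proof.
apply: measurable_fun_row => i; case: (unliftP ord0 i) => [j|] ->.
- under eq_fun do rewrite row_consS.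
  by apply: (measurableT_comp (measurable_coord j)); exact: measurable_snd.
- by under eq_fun do rewrite row_cons0; exact: measurable_fst.
Qed.

Lemma measurable_row_uncons n : measurable_fun setT (@row_uncons n).
Proof.
apply/measurable_fun_pairP; split; first exact: measurable_coord.
apply: measurable_fun_row => i.
rewrite (_ : (fun _ => _) = fun v : 'rV[T]_n.+1 => v ord0 (rshift 1 i)).
  exact: measurable_coord.
by apply/funext => v /=; rewrite mxE.
Qed.


Variable mu : {sigma_finite_measure set T -> \bar R}.

Section cons_measure.
Variables (n : nat) (nu : {sigma_finite_measure set 'rV[T]_n -> \bar R}).

Definition cons_measure : set 'rV[T]_n.+1 -> \bar R :=
  pushforward (mu \x nu)%E (@row_cons n).

Let mcons := @measurable_row_cons n.

Let cons_measure0 : cons_measure set0 = 0%E.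
Proof. by rewrite /cons_measure /pushforward preimage_set0 measure0. Qed.

Let cons_measure_ge0 A : (0 <= cons_measure A)%E.
Proof. exact: measure_ge0. Qed.

Let cons_measure_sigma_additive : semi_sigma_additive cons_measure.
Proof. exact: measure_semi_sigma_additive. Qed.

HB.instance Definition _ := isMeasure.Build _ _ _ cons_measure
  cons_measure0 cons_measure_ge0 cons_measure_sigma_additive.

Let cons_measure_sigma_finite : sigma_finite setT cons_measure.
Proof.
have /sigma_finiteP[F [TF ndF Foo]] := sigma_finiteT mu.
have /sigma_finiteP[G [TG ndG Goo]] := sigma_finiteT nu.
exists (fun k => @row_uncons n @^-1` (F k `*` G k)).
  rewrite -preimage_bigcup (_ : \bigcup_k _ = setT) ?preimage_setT//.
  apply/seteqP; split => // -[x v] _.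
  have [i _ Fx] : (\bigcup_k F k) x by rewrite -TF.
  have [j _ Gv] : (\bigcup_k G k) v by rewrite -TG.
  exists (maxn i j) => //; split => /=.
  - by move: x Fx; exact/subsetPset/ndF/leq_maxl.
  - by move: v Gv; exact/subsetPset/ndG/leq_maxr.
move=> k; have [mF Fk] := Foo k; have [mG Gk] := Goo k; split.
  rewrite -[X in measurable X]setTI.
  by apply: measurable_row_uncons => //; exact: measurableX.
rewrite /cons_measure /pushforward (_ : _ @^-1` _ = F k `*` G k); last first.
  rewrite -comp_preimage (_ : _ \o _ = id) ?preimage_id//.
  by apply/funext => x; exact: row_consK.
by rewrite product_measure1E// lte_mul_pinfty// ge0_fin_numE.
Qed.

HB.instance Definition _ := Measure_isSigmaFinite.Build _ _ _ cons_measure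
  cons_measure_sigma_finite.

End cons_measure.

(* The n-fold product of [mu] on row vectors, characterised on boxes by
   [power_measure_box]. *)
Fixpoint power_measure n : {sigma_finite_measure set 'rV[T]_n -> \bar R} :=
  if n is m.+1 then cons_measure (power_measure m)
  else @dirac _ 'rV[T]_0 point R.

Lemma power_measure_box n (A : 'I_n -> set T) :
  (forall i, measurable (A i)) ->
  power_measure n [set v | forall i, A i (v ord0 i)] = (\prod_(i < n) mu (A i))%E.
Proof.
elim: n A => [|n IH] A mA /=.
  by rewrite big_ord0 diracE mem_set// => -[].
have mB : measurable [set v : 'rV[T]_n | forall i, A (lift ord0 i) (v ord0 i)].
  rewrite (_ : mkset _ =
      \big[setI/setT]_i ((fun v : 'rV[T]_n => v ord0 i) @^-1` A (lift ord0 i))).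
    apply: bigsetI_measurable => i _.
    by rewrite -[X in measurable X]setTI; exact: measurable_coord.
  by rewrite -bigcap_seq; apply/seteqP; split => v /= vA i;
    [move=> _; exact: vA|apply: vA; rewrite /= mem_index_enum].
rewrite big_ord_recl -IH// -product_measure1E//.
rewrite /cons_measure /pushforward; congr (_ _).
apply/seteqP; split => -[x v] /=.
- move=> xvA; split => /= [|j].
    by have := xvA ord0; rewrite row_cons0.
  by have := xvA (lift ord0 j); rewrite row_consS.
- move=> [Ax Av] i; case: (unliftP ord0 i) => [j|] ->.
    by rewrite row_consS; exact: Av.
  by rewrite row_cons0.
Qed.

End power_measure.

Section circle.
Context {R : realType}.

Definition two_pi_Z : {pred R} :=
  [pred x | `[< exists m : int, x = 2 * m%:~R * pi >]].

Lemma two_pi_Z_zmod_closed : zmod_closed two_pi_Z.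
Proof.
split; first by apply/asboolP; exists 0; rewrite mulr0 mul0r.
move=> x y /asboolP[a ->] /asboolP[b ->]; apply/asboolP; exists (a - b).
by rewrite intrB mulrBr mulrBl.
Qed.

HB.instance Definition _ :=
  GRing.isZmodClosed.Build R two_pi_Z two_pi_Z_zmod_closed.

End circle.

Section circle.
Variable R : realType.
Local Notation quotR := (ring_quotient.Quotient.quot (@two_pi_Z R)).

(* R / 2 pi Z, with the quotient topology and the quotient group law. *)
Definition circle : Type := quotient_topology quotR.

HB.instance Definition _ := Quotient.on circle.
HB.instance Definition _ := Topological.on circle.
HB.instance Definition _ := Pointed.on circle.
HB.instance Definition _ := GRing.isZmodule.Build circle
  (@ring_quotient.Quotient.addqA R two_pi_Z)
  (@ring_quotient.Quotient.addqC R two_pi_Z)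
  (@ring_quotient.Quotient.add0q R two_pi_Z)
  (@ring_quotient.Quotient.addNq R two_pi_Z).

Definition to_circle (x : R) : circle := \pi_circle%qT x.

Lemma to_circleD : {morph to_circle : x y / x + y}.
Proof. exact: ring_quotient.Quotient.pi_add. Qed.

Lemma to_circle_eq x y :
  to_circle x = to_circle y <-> exists m : int, x - y = 2 * m%:~R * pi.
Proof.
split=> [xy|xy].
  have /eqP : (x = y %[mod quotR])%qT := xy.
  by rewrite -ring_quotient.Quotient.idealrBE => /asboolP.
suff /eqP : (x == y %[mod quotR])%qT by [].
by rewrite -ring_quotient.Quotient.idealrBE; exact/asboolP.
Qed.

Lemma continuous_to_circle : continuous to_circle.
Proof. exact: (@pi_continuous _ quotR). Qed.

(* Since [to_circle] is a local homeomorphism, these are exactly the Borel sets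
   of the quotient topology. *)
Definition circle_measurable : set (set circle) :=
  [set A | measurable (to_circle @^-1` A)].

Let circle_measurable0 : circle_measurable set0.
Proof. by rewrite /circle_measurable /= preimage_set0. Qed.

Let circle_measurableC A : circle_measurable A -> circle_measurable (~` A).
Proof. by rewrite /circle_measurable /= preimage_setC; exact: measurableC. Qed.

Let circle_measurable_bigcup (F : (set circle)^nat) :
  (forall k, circle_measurable (F k)) -> circle_measurable (\bigcup_k F k).
Proof.
move=> mF; rewrite /circle_measurable /= preimage_bigcup.
by apply: bigcupT_measurable => k; exact: mF.
Qed.

HB.instance Definition _ := @isMeasurable.Build default_measure_display circle
  circle_measurable circle_measurable0 circle_measurableC circle_measurable_bigcup.

Lemma measurable_to_circle : measurable_fun setT to_circle.
Proof. by move=> _ A mA; rewrite setTI. Qed.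

End circle.

Section lebesgue.
Context {R : realType}.

(* [lebesgue_measure] for the Borel sets of [R] itself rather than for the
   convertible type [measurableTypeR R], which carries another display. *)
Definition real_lebesgue : set R -> \bar R := @lebesgue_measure R.

Let real_lebesgue0 : real_lebesgue set0 = 0%E.
Proof. exact: (measure0 (@lebesgue_measure R)). Qed.

Let real_lebesgue_ge0 A : (0 <= real_lebesgue A)%E.
Proof. exact: (measure_ge0 (@lebesgue_measure R)). Qed.

Let real_lebesgue_sigma_additive : semi_sigma_additive real_lebesgue.
Proof. exact: (@measure_semi_sigma_additive _ _ _ (@lebesgue_measure R)). Qed.

HB.instance Definition _ := isMeasure.Build _ _ _ real_lebesgue
  real_lebesgue0 real_lebesgue_ge0 real_lebesgue_sigma_additive.

Let real_lebesgue_sigma_finite : sigma_finite setT real_lebesgue.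
Proof. exact: (sigma_finiteT (@lebesgue_measure R)). Qed.

HB.instance Definition _ := Measure_isSigmaFinite.Build _ _ _ real_lebesgue
  real_lebesgue_sigma_finite.

(* Lebesgue measure of total mass 2 pi, see [circle_measureT]. *)
Definition circle_measure : set (circle R) -> \bar R :=
  pushforward
    (mrestr real_lebesgue (measurable_itv `[0, 2 * pi[))
    (@to_circle R).

Let mto_circle := @measurable_to_circle R.

Let circle_measure0 : circle_measure set0 = 0%E.
Proof. by rewrite /circle_measure /pushforward preimage_set0 measure0. Qed.

Let circle_measure_ge0 A : (0 <= circle_measure A)%E.
Proof. exact: measure_ge0. Qed.

Let circle_measure_sigma_additive : semi_sigma_additive circle_measure.
Proof. exact: measure_semi_sigma_additive. Qed.

HB.instance Definition _ := isMeasure.Build _ _ _ circle_measure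
  circle_measure0 circle_measure_ge0 circle_measure_sigma_additive.

Lemma circle_measureT : circle_measure setT = (2 * pi)%:E.
Proof.
rewrite /circle_measure /pushforward preimage_setT /mrestr setTI.
rewrite [LHS](@lebesgue_measure_itv R `[0, 2 * pi[)/= lte_fin.
by rewrite mulr_gt0 ?pi_gt0// EFinN sube0.
Qed.

Let circle_measure_finite : fin_num_fun circle_measure.
Proof.
apply: lty_fin_num_fun.
exact: (eq_ind_r (fun x => x < +oo)%E (ltry (2 * pi)) circle_measureT).
Qed.

HB.instance Definition _ := Measure_isFinite.Build _ _ _ circle_measure
  circle_measure_finite.

End lebesgue.

Notation torus R n := 'rV[circle R]_n.

Section dynamics.
Context {R : realType} {n : nat}.
Local Notation C := (R[i]^o).

Definition lebesgue_space : {sigma_finite_measure set 'rV[R]_n -> \bar R} :=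
  power_measure (@real_lebesgue R) n.

Definition lebesgue_torus : {sigma_finite_measure set torus R n -> \bar R} :=
  power_measure (@circle_measure R) n.

Lemma lebesgue_torusT : lebesgue_torus setT = ((2 * pi) ^+ n)%:E.
Proof.
have := @power_measure_box _ _ _ (@circle_measure R) n (fun=> setT)
  (fun=> measurableT).
rewrite (_ : [set v | _] = setT); last by apply/seteqP; split.
rewrite (eq_bigr (fun=> (2 * pi)%:E)) => [|i _]; last exact: circle_measureT.
by rewrite prodEFin prodr_const card_ord.
Qed.

Definition lebesgue_phase : {measure set ('rV[R]_n * torus R n) -> \bar R} :=
  (lebesgue_space \x lebesgue_torus)%E.

Definition to_torus (x : 'rV[R]_n) : torus R n := map_mx (@to_circle R) x.

Lemma to_torusD : {morph to_torus : x y / x + y}.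
Proof. by move=> x y; apply/rowP => i; rewrite !mxE to_circleD. Qed.

Lemma to_torus0 : to_torus 0 = 0.
Proof. by apply: (addrI (to_torus 0)); rewrite -to_torusD !addr0. Qed.

Definition gradient (h : 'rV[R]_n -> R) (x : 'rV[R]_n) : 'rV[R]_n :=
  \row_(i < n) 'D_(delta_mx ord0 i) h x.

Definition cintegral d (T : measurableType d) (mu : {measure set T -> \bar R})
    (D : set T) (f : T -> C) : C :=
  (\int[mu]_(x in D) complex.Re (f x))%R +i*
  (\int[mu]_(x in D) complex.Im (f x))%R.

(* The j-th iterate of (I, theta) |-> (I, theta + omega I), see
   [rotation_iterE]. *)
Definition rotation_iter (omega : 'rV[R]_n -> 'rV[R]_n) (j : nat)
    (p : 'rV[R]_n * torus R n) : 'rV[R]_n * torus R n :=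
  (p.1, p.2 + to_torus (omega p.1 *+ j)).

Lemma rotation_iterE omega j :
  rotation_iter omega j = iter j (rotation_iter omega 1).
Proof.
apply/funext => -[I theta]; elim: j => [|j IHj] /=.
  by rewrite /rotation_iter/= mulr0n to_torus0 addr0.
by rewrite -IHj /rotation_iter/= mulrSr to_torusD addrA mulr1n.
Qed.

(* The weight [rho0] stays at time 0, the observable is transported. *)
Definition ensemble_average (Omega : set 'rV[R]_n)
    (omega : 'rV[R]_n -> 'rV[R]_n) (rho0 : 'rV[R]_n * torus R n -> R)
    (j : nat) (G : 'rV[R]_n * torus R n -> C) : C :=
  cintegral lebesgue_phase (Omega `*` setT)
    (fun p => G (rotation_iter omega j p) * (rho0 p)%:C).

Definition angle_average (G : 'rV[R]_n * torus R n -> C) (I : 'rV[R]_n) : C :=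
  ((2 * pi) ^- n)%:C * cintegral lebesgue_torus setT (fun theta => G (I, theta)).

End dynamics.

(* Main.v *)
(* For each fixed [(I, theta)] the time averages along the orbit converge to the
   torus mean (Weyl), and dominated convergence with dominating function
   [M * rho0] integrates this over phase space.

   Weyl's theorem is obtained from trigonometric polynomials, for which the sums
   of [cos (a + j b)] telescope.  A continuous function on the torus is
   uniformly approximated by averaging it over a finite grid against products of
   Fejer kernels: on a sufficiently fine grid the discrete mean of the Fejer
   kernel [F_m] is exactly 1 and that of [F_m * (1 - cos)] is exactly [1 / m],
   so Korovkin's argument applies and no integral is needed.

   Measurability of [omega] follows from its being a pointwise limit of
   difference quotients of [h]. *)
Require Import Defs.
From mathcomp Require Import all_boot all_order all_algebra.
From mathcomp Require Import complex.
From mathcomp Require Import all_classical all_reals all_analysis.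
From mathcomp Require Import measurable_realfun.
From mathcomp Require Import ring lra zify.

Set Implicit Arguments.
Unset Strict Implicit.
Unset Printing Implicit Defensive.

Import Order.TTheory GRing.Theory Num.Theory.
Import numFieldNormedType.Exports.

Local Open Scope classical_set_scope.
Local Open Scope ring_scope.
Local Open Scope complex_scope.

(** * Trigonometric sums *)

Section trigonometric_sums.
Context {R : realType}.
Implicit Types (a b x : R).

Lemma sin_cosDintpi (m : int) x :
  sin (x + m%:~R * pi) = (-1) ^+ `|m|%N * sin x /\
  cos (x + m%:~R * pi) = (-1) ^+ `|m|%N * cos x.
Proof.
have nat_case (k : nat) (y : R) : sin (y + k%:R * pi) = (-1) ^+ k * sin y /\
    cos (y + k%:R * pi) = (-1) ^+ k * cos y.
  elim: k y => [|k IH] y; first by rewrite mul0r addr0 expr0 !mul1r.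
  rewrite -natr1 mulrDl mul1r addrA sinDpi cosDpi exprS.
  by case: (IH y) => -> ->; rewrite -!mulrA !mulN1r.
case: (intP m) => [|k|k].
- by rewrite mulr0z mul0r addr0 expr0 !mul1r.
- exact: (nat_case k.+1 x).
(* The natural case, taken at [x - k.+1 * pi], is multiplied by its sign, which is its own
   inverse. *)
- rewrite abszN absz_nat intrN mulNr.
  have [/(congr1 ( *%R ((-1) ^+ k.+1))) + /(congr1 ( *%R ((-1) ^+ k.+1)))] :=
    nat_case k.+1 (x - k.+1%:R * pi).
  by rewrite subrK !mulrA -!expr2 !sqrr_sign !mul1r.
Qed.

Lemma cosD2intpi (m : int) x : cos (x + 2 * m%:~R * pi) = cos x.
Proof.
have [_] := sin_cosDintpi (2 * m) x.
rewrite intrM => ->.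
by rewrite abszM exprM sqrrN !expr1n mul1r.
Qed.

(** Subtracting [floor (x / pi)] times [pi] moves [x] into [[0, pi)] and changes the sine only by a
    sign; on the open interval the sine is positive. *)
Lemma sin_eq0_intpi x : sin x = 0 -> exists m : int, x = m%:~R * pi.
Proof.
move=> x0; pose m := Num.floor (x / pi); exists m.
have pi0 : 0 < pi :> R := pi_gt0 R.
have /andP[mx xm] := floor_itv (x / pi).
have [+ _] := sin_cosDintpi (- m) x.
rewrite x0 mulr0 intrN mulNr => s0; apply/eqP; rewrite -subr_eq0 eq_le.
move: mx xm; rewrite -/m ler_pdivlMr// ltr_pdivrMr// => mx xm.
rewrite !subr_ge0 mx andbT leNgt; apply/negP => xgt.
suff : 0 < sin (x - m%:~R * pi) by rewrite s0 ltxx.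
apply: sin_gt0_pi; rewrite subr_gt0; apply/andP; split; first by lra.
by move: xm; rewrite intrD mulrDl mul1r; lra.
Qed.

(* [2 sin (b/2) cos (a + j b)] is the increment of [sin (a + (j - 1/2) b)]. *)
Lemma sum_cos_arith a b (N : nat) :
  2 * sin (b / 2) * \sum_(j < N) cos (a + j%:R * b) =
  sin (a + N%:R * b - b / 2) - sin (a - b / 2).
Proof.
elim: N => [|N IH]; first by rewrite big_ord0 mulr0 mul0r addr0 subrr.
rewrite big_ord_recr /= mulrDr IH.
rewrite (_ : a + N.+1%:R * b - b / 2 = (a + N%:R * b) + b / 2);
  last by rewrite -natr1; field.
by rewrite (sinB (a + N%:R * b)) (sinD (a + N%:R * b)); ring.
Qed.

(** Nonresonance makes [sin (b / 2)] nonzero, so the telescoped sums stay bounded in [N] and the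
    factor [1 / N] sends them to 0. *)
Lemma cesaro_cos_cvg0 a b : (forall m : int, b <> 2 * m%:~R * pi) ->
  (fun N : nat => N%:R^-1 * \sum_(j < N) cos (a + j%:R * b)) @ \oo --> (0 : R).
Proof.
move=> nres; have s0 : sin (b / 2) != 0.
  apply/eqP => /sin_eq0_intpi[m bm]; apply: (nres m).
  by rewrite -mulrA -bm mulrC divfK.
have -> : (0 : R) = 0 * 0 by rewrite mul0r.
pose c := 2 * sin (b / 2).
have c0 : c != 0 by rewrite mulf_neq0.
have bounded N : `|\sum_(j < N) cos (a + j%:R * b)| <= 2 / `|c|.
  rewrite ler_pdivlMr ?normr_gt0// -normrM mulrC sum_cos_arith.
  apply: (le_trans (ler_normB _ _)).
  by rewrite (_ : 2 = 1 + 1)// lerD// ler_norml sin_geN1 sin_le1.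
rewrite mul0r; apply/cvgrPdist_le => e e0.
near=> N; rewrite sub0r normrN normrM.
have N0 : 0 < N%:R :> R by rewrite ltr0n; near: N; exact: nbhs_infty_gt.
rewrite gtr0_norm ?invr_gt0// mulrC ler_pdivrMr//.
apply: (le_trans (bounded N)); rewrite -ler_pdivrMl//.
near: N; exact: nbhs_infty_ger.
Unshelve. all: by end_near. Qed.

Definition grid_point (L l : nat) : R := 2 * pi * l%:R / L%:R.

(** Discrete orthogonality of characters: for nonzero [d] the sum telescopes to two sines whose
    arguments differ by a multiple of [2 pi]. *)
Lemma grid_sum_cos (L : nat) (d : int) x : (`|d| < L)%N ->
  \sum_(l < L) cos (d%:~R * (x - grid_point L l)) = (d == 0)%:R * L%:R.
Proof.
move=> dL; have L0 : L%:R != 0 :> R.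
  by rewrite pnatr_eq0 -lt0n (leq_ltn_trans _ dL).
have [->|d0] := eqVneq d 0.
  under eq_bigr do rewrite mul0r cos0.
  by rewrite big_const_ord iter_addr_0 mul1r.
rewrite mul0r; pose b : R := - (2 * d%:~R * pi / L%:R).
(* A zero of this sine would make [d] a multiple of [L], which [0 < |d| < L] excludes. *)
have s0 : 2 * sin (b / 2) != 0.
  rewrite mulf_neq0//; apply/eqP => /sin_eq0_intpi[m].
  rewrite /b (_ : - _ / 2 = - (d%:~R / L%:R) * pi); last by field.
  move/(mulIf (lt0r_neq0 (pi_gt0 R)))/(congr1 ( *%R^~ L%:R)).
  rewrite mulNr divfK// => /esym dm.
  have {dm}dm : d = - m * L%:Z.
    by apply/eqP; rewrite -(eqr_int R) intrM intrN mulNr dm opprK.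
  move: dL d0; rewrite dm abszM abszN absz_nat.
  case: (`|m|%N =P 0%N) => [/eqP|/eqP].
    by rewrite absz_eq0 => /eqP->; rewrite oppr0 mul0r eqxx.
  by rewrite -lt0n => m0; rewrite ltnNge leq_pmull.
apply: (mulfI s0); rewrite mulr0.
rewrite (eq_bigr (fun l : 'I_L => cos (d%:~R * x + l%:R * b))); last first.
  by move=> l _; congr cos; rewrite /b /grid_point; field.
rewrite sum_cos_arith.
rewrite (_ : d%:~R * x + L%:R * b - b / 2 =
   d%:~R * x - b / 2 + (- (2 * d))%:~R * pi); last first.
  by rewrite intrN intrM /b; field.
have [-> _] := sin_cosDintpi (- (2 * d)) (d%:~R * x - b / 2).
by rewrite abszN abszM exprM sqrrN !expr1n mul1r subrr.
Qed.

End trigonometric_sums.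

(** * Fejér kernels and their exact means over a grid *)

Section fejer_kernel.
Context {R : realType}.
Implicit Types (x t : R) (m L : nat).

(** This is [1/m] times the squared modulus of the sum of [e^(ijt)] over [j < m]. Expanded over
    pairs, it exposes the frequencies [j - k], so that [grid_sum_cos] applies term by term. *)
Definition fejer m t : R :=
  m%:R^-1 * \sum_(j < m) \sum_(k < m) cos ((j%:Z - k%:Z)%:~R * t).

Lemma fejer_ge0 m t : 0 <= fejer m t.
Proof.
rewrite mulr_ge0 ?invr_ge0//.
(* The squared modulus is recovered from its real and imaginary parts. *)
rewrite (_ : \sum_(j < m) _ =
  (\sum_(j < m) cos (j%:R * t)) ^+ 2 + (\sum_(j < m) sin (j%:R * t)) ^+ 2).
  by rewrite addr_ge0// sqr_ge0.
rewrite !expr2 !big_distrl -big_split; apply: eq_bigr => j _.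
rewrite !big_distrr -big_split; apply: eq_bigr => k _ /=.
by rewrite intrB mulrBl cosB.
Qed.

(** Off the diagonal the frequencies satisfy [0 < |j - k| < L] and cancel; the [m] diagonal terms
    contribute [L] each. *)
Lemma grid_sum_fejer m L x : (0 < m <= L)%N ->
  \sum_(l < L) fejer m (x - grid_point L l) = L%:R.
Proof.
move=> /andP[m0 mL]; rewrite -mulr_sumr exchange_big /=.
rewrite (eq_bigr (fun=> L%:R)) => [|j _].
  rewrite big_const_ord iter_addr_0.
  rewrite -(mulr_natr L%:R m) mulrCA mulVf ?mulr1//.
  by rewrite pnatr_eq0 -lt0n.
rewrite exchange_big (bigD1 j)//= subrr grid_sum_cos ?(leq_trans m0)//.
rewrite mul1r big1 ?addr0// => k kj; rewrite grid_sum_cos.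
  by rewrite subr_eq0 eqz_nat (inj_eq val_inj) eq_sym (negbTE kj) mul0r.
have := ltn_ord j; have := ltn_ord k; lia.
Qed.

(* Multiplying by [cos] shifts frequencies by one, and exactly [m - 1] pairs
   [j, k < m] satisfy [j - k = 1]. *)
Lemma grid_sum_fejer_cos m L x : (0 < m < L)%N ->
  \sum_(l < L) fejer m (x - grid_point L l) * (1 - cos (x - grid_point L l)) =
  L%:R / m%:R.
Proof.
move=> /andP[m0 mL].
have mR0 : m%:R != 0 :> R by rewrite pnatr_eq0 -lt0n.
under eq_bigr do rewrite mulrBr mulr1.
rewrite sumrB grid_sum_fejer ?m0 1?ltnW//.
(* The index [j = 0] has no predecessor, and every other [j] has exactly one. *)
have pairs : \sum_(j < m) \sum_(k < m) (j == k.+1 :> nat)%:R = m%:R - 1 :> R.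
  case: m m0 {mL mR0} => // m _.
  rewrite big_ord_recl /= big1 ?add0r; last by [].
  rewrite (eq_bigr (fun=> 1)) => [|j _].
    by rewrite big_const_ord iter_addr_0 -natr1 addrK.
  rewrite (bigD1 (widen_ord (leqnSn m) j))//= /bump leq0n add1n eqxx.
  rewrite big1 ?addr0// => k kj.
  rewrite eqSS; have [jk|//] := eqVneq (j : nat) k.
  by case/eqP: kj; apply: val_inj; rewrite /= -jk.
suff -> : \sum_(l < L) fejer m (x - grid_point L l) * cos (x - grid_point L l) =
    m%:R^-1 * (L%:R * (m%:R - 1)) by field.
rewrite /fejer; under eq_bigr do rewrite -mulrA.
rewrite -mulr_sumr; congr (_ * _).
under eq_bigr do rewrite big_distrl.
rewrite exchange_big /= (_ : _ * _ =
    L%:R / 2 * (m%:R - 1) + L%:R / 2 * (m%:R - 1)); last by field.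
(* The two copies of the count match the frequencies [j - k + 1] and [j - k - 1] of the product
   formula, once the indices are exchanged in one copy. *)
rewrite -{1}pairs -pairs [X in _ + _ * X]exchange_big /= !mulr_sumr -big_split.
apply: eq_bigr => j _ /=.
under eq_bigr do rewrite big_distrl.
rewrite exchange_big /= !mulr_sumr -big_split; apply: eq_bigr => k _ /=.
have prodcos (d : int) t : cos (d%:~R * t) * cos t =
    2^-1 * (cos ((d + 1)%:~R * t) + cos ((d - 1)%:~R * t)).
  by rewrite intrD intrB mulrDl mulrBl mul1r cosD cosB; field.
under eq_bigr do rewrite prodcos.
rewrite -mulr_sumr big_split /= !grid_sum_cos; first 1 last.
- have := ltn_ord j; have := ltn_ord k; lia.
- have := ltn_ord j; have := ltn_ord k; lia.
have -> : (j%:Z - k%:Z + 1 == 0) = (k == j.+1 :> nat) by lia.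
have -> : (j%:Z - k%:Z - 1 == 0) = (j == k.+1 :> nat) by lia.
by field.
Qed.

End fejer_kernel.

(** * Trigonometric polynomials *)

Section trigonometric_polynomials.
Context {R : realType} {n : nat}.
Implicit Types (x y : 'rV[R]_n) (f g : 'rV[R]_n -> R).

Definition pairing (k : 'rV[int]_n) x : R :=
  \sum_(i < n) (k ord0 i)%:~R * x ord0 i.

(** The free phase [phi] lets real cosines alone account for sines and constants, so every generator
    is covered by one product formula. *)
Inductive trig_poly : ('rV[R]_n -> R) -> Prop :=
| trig_poly_cos k phi : trig_poly (fun x => cos (pairing k x + phi))
| trig_polyD f g : trig_poly f -> trig_poly g ->
    trig_poly (fun x => f x + g x)
| trig_polyZ (c : R) f : trig_poly f -> trig_poly (fun x => c * f x).

Lemma pairing0 x : pairing 0 x = 0.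
Proof. by rewrite /pairing big1// => i _; rewrite mxE mul0r. Qed.

Lemma pairingDl k k' x : pairing (k + k') x = pairing k x + pairing k' x.
Proof.
by rewrite -big_split; apply: eq_bigr => i _; rewrite mxE intrD mulrDl.
Qed.

Lemma pairingNl k x : pairing (- k) x = - pairing k x.
Proof.
by rewrite /pairing -sumrN; apply: eq_bigr => i _; rewrite mxE intrN mulNr.
Qed.

Lemma pairingDr k x y : pairing k (x + y) = pairing k x + pairing k y.
Proof.
by rewrite -big_split; apply: eq_bigr => i _; rewrite mxE mulrDr.
Qed.

Lemma pairing_mulrn k x (j : nat) : pairing k (x *+ j) = j%:R * pairing k x.
Proof.
by rewrite /pairing mulr_sumr; apply: eq_bigr => i _;
   rewrite mulmxnE -mulr_natl; ring.
Qed.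

Lemma pairing_delta (d : int) i x :
  pairing (d *: delta_mx ord0 i) x = d%:~R * x ord0 i.
Proof.
rewrite /pairing (bigD1 i)//= big1 ?addr0 => [|j ji];
  rewrite !mxE !eqxx ?mulr1//.
by rewrite (negbTE ji) mulr0 mul0r.
Qed.

Lemma trig_poly_cst (c : R) : trig_poly (fun=> c).
Proof.
rewrite (_ : (fun=> c) = fun x => c * cos (pairing 0 x + 0)).
  exact/trig_polyZ/trig_poly_cos.
by apply/funext => x; rewrite pairing0 addr0 cos0 mulr1.
Qed.

(** Induction on both factors reduces to a product of two cosines, which is half the sum of the
    cosines with added and subtracted frequencies and phases. *)
Lemma trig_polyM f g : trig_poly f -> trig_poly g ->
  trig_poly (fun x => f x * g x).
Proof.
move=> + tg; elim=> [k phi|f1 f2 _ t1 _ t2|c f1 _ t1]; last 2 first.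
- rewrite (_ : (fun _ => _) = (fun x => f1 x * g x + f2 x * g x)).
    exact: trig_polyD.
  by apply/funext => x; rewrite mulrDl.
- rewrite (_ : (fun _ => _) = (fun x => c * (f1 x * g x))).
    exact: trig_polyZ.
  by apply/funext => x; rewrite mulrA.
elim: tg => [k' phi'|g1 g2 _ t1 _ t2|c g1 _ t1].
- rewrite (_ : (fun _ => _) = (fun x =>
    2^-1 * (cos (pairing (k + k') x + (phi + phi')) +
            cos (pairing (k - k') x + (phi - phi'))))).
    by apply/trig_polyZ/trig_polyD; exact: trig_poly_cos.
  apply/funext => x; rewrite !pairingDl pairingNl.
  rewrite (_ : pairing k x + pairing k' x + (phi + phi') =
    (pairing k x + phi) + (pairing k' x + phi')); last by ring.
  rewrite (_ : pairing k x - pairing k' x + (phi - phi') =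
    (pairing k x + phi) - (pairing k' x + phi')); last by ring.
  by rewrite [X in _ = _ * (X + _)]cosD [X in _ = _ * (_ + X)]cosB; field.
- rewrite (_ : (fun _ => _) = (fun x => cos (pairing k x + phi) * g1 x +
                                         cos (pairing k x + phi) * g2 x)).
    exact: trig_polyD.
  by apply/funext => x; rewrite mulrDr.
- rewrite (_ : (fun _ => _) = (fun x => c * (cos (pairing k x + phi) * g1 x))).
    exact: trig_polyZ.
  by apply/funext => x; rewrite mulrCA.
Qed.

Lemma trig_poly_sum (I : Type) (r : seq I) (F : I -> 'rV[R]_n -> R) :
  (forall i, trig_poly (F i)) -> trig_poly (fun x => \sum_(i <- r) F i x).
Proof.
move=> tF; elim: r => [|i r IH].
  by under eq_fun do rewrite big_nil; exact: trig_poly_cst.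
by under eq_fun do rewrite big_cons; exact: trig_polyD.
Qed.

Lemma trig_poly_prod (I : Type) (r : seq I) (F : I -> 'rV[R]_n -> R) :
  (forall i, trig_poly (F i)) -> trig_poly (fun x => \prod_(i <- r) F i x).
Proof.
move=> tF; elim: r => [|i r IH].
  by under eq_fun do rewrite big_nil; exact: trig_poly_cst.
by under eq_fun do rewrite big_cons; exact: trig_polyM.
Qed.

Lemma trig_poly_fejer m i (t : R) : trig_poly (fun x => fejer m (x ord0 i - t)).
Proof.
apply/trig_polyZ/trig_poly_sum => j; apply: trig_poly_sum => k.
set d := j%:Z - k%:Z.
rewrite (_ : (fun _ => _) =
    fun x => cos (pairing (d *: delta_mx ord0 i) x - d%:~R * t)).
  exact: trig_poly_cos.
by apply/funext => x; rewrite pairing_delta mulrBr.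
Qed.

(** * Product kernels on the grid and Korovkin approximation *)

Section discrete_fejer_approximation.
Context (m L : nat) (mL : (0 < m < L)%N).

Let mL' : (0 < m <= L)%N. Proof. by case/andP: mL => -> /ltnW ->. Qed.

Definition grid_vector (l : {ffun 'I_n -> 'I_L}) : 'rV[R]_n :=
  \row_i grid_point L (l i).

Definition grid_kernel x (l : {ffun 'I_n -> 'I_L}) : R :=
  \prod_(i < n) fejer m (x ord0 i - grid_point L (l i)).

Lemma grid_kernel_ge0 x l : 0 <= grid_kernel x l.
Proof. by apply: prodr_ge0 => i _; exact: fejer_ge0. Qed.

(** A sum over all functions [l] of a product over coordinates is a product of one-dimensional grid
    sums. *)
Lemma sum_grid_kernel x : \sum_l grid_kernel x l = L%:R ^+ n.
Proof.
rewrite -(bigA_distr_bigA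
  (fun i (l : 'I_L) => fejer m (x ord0 i - grid_point L l))).
under eq_bigr do rewrite grid_sum_fejer ?mL'//.
by rewrite prodr_const card_ord.
Qed.

Lemma sum_grid_kernel_cos x i0 :
  \sum_l grid_kernel x l * (1 - cos (x ord0 i0 - grid_vector l ord0 i0)) =
  L%:R ^+ n / m%:R.
Proof.
(* The test function is absorbed into the factor of coordinate [i0], so distributivity yields one
   factor [L / m] and [L] for every other coordinate. *)
pose F i (l : 'I_L) : R := fejer m (x ord0 i - grid_point L l) *
  (if i == i0 then 1 - cos (x ord0 i0 - grid_point L l) else 1).
rewrite (eq_bigr (fun l : {ffun 'I_n -> 'I_L} => \prod_i F i (l i)));
  last first.
  move=> l _; rewrite big_split /=; congr (_ * _).
  by rewrite -big_mkcond big_pred1_eq mxE.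
rewrite -(bigA_distr_bigA F) (bigD1 i0)//= /F eqxx grid_sum_fejer_cos//.
rewrite (eq_bigr (fun=> L%:R)) => [|i /negbTE ->]; last first.
  under eq_bigr do rewrite mulr1.
  by rewrite grid_sum_fejer ?mL'.
rewrite mulrAC; congr (_ / _).
have <- : \prod_(i < n) L%:R = L%:R ^+ n :> R by rewrite prodr_const card_ord.
by rewrite [RHS](bigD1 i0).
Qed.

End discrete_fejer_approximation.

(* The hypothesis is a uniform modulus of continuity measured by the Korovkin
   test functions [1 - cos (x_i - y_i)]. *)
Lemma trig_poly_approx f :
  (forall e, 0 < e -> exists C : R, forall x y,
    `|f x - f y| <= e + C * \sum_(i < n) (1 - cos (x ord0 i - y ord0 i))) ->
  forall e, 0 < e -> exists2 P, trig_poly P & forall x, `|f x - P x| <= e.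
Proof.
move=> modf e e0; have e20 : 0 < e / 2 by rewrite divr_gt0.
have [C0 fC0] := modf _ e20; pose C := `|C0|.
have C_ge0 : 0 <= C by exact: normr_ge0.
have fC x y : `|f x - f y| <=
    e / 2 + C * \sum_(i < n) (1 - cos (x ord0 i - y ord0 i)).
  apply: (le_trans (fC0 x y)); rewrite lerD2l ler_wpM2r ?ler_norm//.
  by apply: sumr_ge0 => i _; rewrite subr_ge0 cos_le1.
(* The [n] test functions contribute an error [C * n / m], which this [m] makes at most [e / 2]; [L]
   must exceed [m] for the grid sums to be exact. *)
pose m := (Num.truncn (C * n%:R / (e / 2))).+1; pose L := m.+1.
have m0 : 0 < m%:R :> R by rewrite ltr0n.
have mL : (0 < m < L)%N by rewrite /L ltnSn.
have mC : C * n%:R / m%:R <= e / 2.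
  by rewrite ler_pdivrMr// -ler_pdivrMl// mulrC ltW// truncnS_gt.
have Ln0 : 0 < L%:R ^+ n :> R by rewrite exprn_gt0// ltr0n.
exists (fun x => (L%:R ^+ n)^-1 *
    \sum_l f (grid_vector l) * grid_kernel (L := L) m x l).
  apply/trig_polyZ/trig_poly_sum => l; apply: trig_polyZ.
  by apply: trig_poly_prod => i; exact: trig_poly_fejer.
(* After multiplication by [L ^ n], the total weight of the kernel, the error is the kernel-weighted
   sum of the differences of [f] between [x] and the grid points. *)
move=> x; rewrite -(ler_pM2l Ln0) -[X in X * `|_|]gtr0_norm// -normrM mulrBr.
rewrite mulVKf ?gt_eqF// -(sum_grid_kernel mL x) mulr_suml -sumrB.
apply: (le_trans (ler_norm_sum _ _ _)).
apply: (@le_trans _ _ (\sum_l grid_kernel m x l * (e / 2 +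
    C * \sum_(i < n) (1 - cos (x ord0 i - grid_vector (L := L) l ord0 i))))).
  apply: ler_sum => l _; rewrite [f _ * _]mulrC -mulrBr normrM.
  by rewrite ger0_norm ?grid_kernel_ge0// ler_wpM2l// grid_kernel_ge0.
under eq_bigr do rewrite mulrDr [X in _ + X]mulrCA mulr_sumr.
rewrite big_split /= -mulr_suml -mulr_sumr exchange_big /=.
rewrite [X in _ + C * X](eq_bigr (fun=> L%:R ^+ n / m%:R)) => [|i _];
  last exact: sum_grid_kernel_cos.
rewrite !sum_grid_kernel// big_const_ord iter_addr_0.
rewrite -(mulr_natr (_ / _)) [X in _ <= _ * X](splitr e) mulrDr lerD2l.
rewrite (_ : C * (_ / _ * _) = L%:R ^+ n * (C * n%:R / m%:R)); last by ring.
by rewrite ler_pM2l.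
Qed.

End trigonometric_polynomials.

(** * Angles and the torus *)

Section angles.
Context {R : realType}.
Implicit Types (x y t : R).

Definition reduce_angle x : R := x - 2 * (Num.floor (x / (2 * pi)))%:~R * pi.

Let twopi_gt0 : 0 < 2 * pi :> R.
Proof. by rewrite mulr_gt0 ?pi_gt0. Qed.

Lemma reduce_angle_itv x : 0 <= reduce_angle x < 2 * pi.
Proof.
have /andP[] := floor_itv (x / (2 * pi)).
rewrite ler_pdivlMr// ltr_pdivrMr// intrD /reduce_angle => x1 x2.
by apply/andP; split; lra.
Qed.

Lemma to_circle_reduce_angle x : to_circle (reduce_angle x) = to_circle x.
Proof.
apply/to_circle_eq; exists (- Num.floor (x / (2 * pi))).
by rewrite intrN /reduce_angle; ring.
Qed.

Lemma reduce_angle_eq x y : to_circle x = to_circle y ->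
  reduce_angle x = reduce_angle y.
Proof.
move=> /to_circle_eq[m xy]; rewrite /reduce_angle.
have -> : x = y + 2 * m%:~R * pi by rewrite -xy addrC subrK.
rewrite (_ : (y + 2 * m%:~R * pi) / (2 * pi) = y / (2 * pi) + m%:~R);
  last first.
  by have := lt0r_neq0 (pi_gt0 R); move: (pi : R) => p p0; field.
by rewrite floorDrz ?intrKfloor// ?intrD; ring.
Qed.

(** [repr] is an arbitrary choice of representative; reducing it gives a section that no longer
    depends on that choice. *)
Definition angle (c : circle R) : R := reduce_angle (repr c).

Lemma angleK c : to_circle (angle c) = c.
Proof. by rewrite to_circle_reduce_angle; exact: reprK. Qed.

Lemma angle_to_circle x : angle (to_circle x) = reduce_angle x.
Proof. by apply: reduce_angle_eq; exact: reprK. Qed.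

Lemma measurable_reduce_angle : measurable_fun setT reduce_angle.
Proof.
apply: measurable_funB => //; apply: measurable_funM => //.
apply: measurable_funM => //.
apply: nondecreasing_measurable => // x y xy.
by rewrite ler_int; apply: le_floor; rewrite ler_pM2r ?invr_gt0.
Qed.

(** Measurability on the circle is tested after pulling back along [to_circle], where [angle]
    becomes [reduce_angle]. *)
Lemma measurable_angle : measurable_fun setT angle.
Proof.
move=> _ A mA; rewrite setTI.
have := measurable_reduce_angle measurableT mA; rewrite setTI.
suff -> : reduce_angle @^-1` A = @to_circle R @^-1` (angle @^-1` A) by [].
by apply/seteqP; split => x /=; rewrite angle_to_circle.
Qed.

Section row.
Context {n : nat}.

Definition angles (theta : torus R n) : 'rV[R]_n := \row_i angle (theta ord0 i).

Lemma anglesK theta : to_torus (angles theta) = theta.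
Proof. by apply/rowP => i; rewrite !mxE angleK. Qed.

Lemma measurable_angles : measurable_fun setT angles.
Proof.
apply: measurable_fun_row => i; under eq_fun do rewrite mxE.
by apply: measurableT_comp (measurable_coord i); exact: measurable_angle.
Qed.

Lemma continuous_to_torus : continuous (@to_torus R n).
Proof.
move=> x A [P nP PA]; exists (fun i j => @to_circle R @^-1` P i j).
  move=> i j; apply: continuous_to_circle.
  by have := nP i j; rewrite mxE.
by move=> y Py; apply: PA => i j; rewrite mxE; exact: Py.
Qed.

(* Compactness is used through the cube [[0, 2 pi]^n], a set of
   representatives; the constant [C] comes from the pairs [x, y] which are not
   close modulo the periods, for which some [1 - cos (x_i - y_i)] is bounded
   below. *)
Lemma torus_modulus (f : torus R n -> R) (M : R) :
  continuous f -> (forall theta, `|f theta| <= M) ->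
  forall e, 0 < e -> exists C : R, forall x y : 'rV[R]_n,
    `|f (to_torus x) - f (to_torus y)| <=
    e + C * \sum_(i < n) (1 - cos (x ord0 i - y ord0 i)).
Proof.
move=> cf fM e e0; pose F (x : 'rV[R]_n) := f (to_torus x).
have cF : continuous F.
  by move=> x; apply: continuous_comp; [exact: continuous_to_torus|exact: cf].
pose K := [set x : 'rV[R]_n | forall i, `[0, 2 * pi]%classic (x ord0 i)].
have cK : compact K.
  apply: (@rV_compact _ _ (fun=> `[0, 2 * pi]%classic)) => i.
  exact: segment_compact.
(* Uniform continuity near the cube: only [x] is confined to [K], since the translate [y'] used
   below may leave it. *)
have : \forall d \near (0 : R)^'+, forall x : 'rV[R]_n, K x ->
    forall y : 'rV[R]_n, (forall i, `|y ord0 i - x ord0 i| < d) ->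
    `|F x - F y| <= e.
  apply: (iffLR (compact_near_coveringP K)) => // x _.
  have e20 : 0 < e / 2 by rewrite divr_gt0.
  have /nbhs_ballP[r r0 xr] : nbhs x [set y | `|F x - F y| < e / 2].
    by move/cvgrPdist_lt : (cF x); exact.
  rewrite /= in r0 xr.
  have r20 : 0 < r / 2 by rewrite divr_gt0.
  exists (ball x (r / 2), [set d | 0 < d < r / 2]).
    split => /=; first exact: nbhsx_ballx.
    by near=> d; apply/andP; split; near: d;
      [exact: nbhs_right_gt|exact: nbhs_right_lt].
  move=> [x' d] [/= [_ xx'] /andP[d0 dr]] y x'y.
  have h1 : `|F x - F x'| < e / 2.
    apply: xr; split=> // i j; apply: le_ball (xx' i j).
    by rewrite /=; lra.
  have h2 : `|F x - F y| < e / 2.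
    apply: xr; split=> // i j; rewrite (splitr r).
    apply: ball_triangle (xx' i j) _; rewrite ord1 /ball/= distrC.
    exact: lt_trans (x'y j) dr.
  rewrite (splitr e) (_ : F x' - F y = (F x - F y) - (F x - F x'));
    last by ring.
  by rewrite (le_trans (ler_normB _ _))// lerD// ltW.
move=> nearF.
have [d [d0 dpi Fd]] : exists d, [/\ 0 < d, d < pi & forall x : 'rV[R]_n, K x ->
    forall y : 'rV[R]_n, (forall i, `|y ord0 i - x ord0 i| < d) ->
    `|F x - F y| <= e].
  near (0 : R)^'+ => d; exists d; split; near: d.
  - exact: nbhs_right_gt.
  - exact/nbhs_right_lt/pi_gt0.
  - exact: nearF.
have cosd : 0 < 1 - cos d.
  rewrite subr_gt0 -[ltRHS]cos0 ltr_cos// in_itv/= ?lexx ?(ltW d0) ?(ltW dpi)//.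
  exact: pi_ge0.
(* [2 * M] bounds every difference of values of [f], and [1 - cos d] bounds one test function from
   below whenever some coordinate is at distance at least [d]. *)
exists (2 * M / (1 - cos d)) => x y.
have M0 : 0 <= M by exact: le_trans (fM (to_torus 0)).
pose x' := \row_i reduce_angle (x ord0 i).
(* Translating [y] by these multiples of [2 pi] brings each coordinate within [pi] of [x'], where
   cosine is monotone in the distance. *)
pose s i : int := Num.floor ((y ord0 i - x' ord0 i + pi) / (2 * pi)).
pose y' := \row_i (y ord0 i - 2 * (s i)%:~R * pi).
have Fx : F x' = F x.
  by congr f; apply/rowP => i; rewrite !mxE to_circle_reduce_angle.
have Fy : F y' = F y.
  congr f; apply/rowP => i; rewrite !mxE; apply/to_circle_eq; exists (- s i).
  by rewrite intrN; ring.
have Kx' : K x'.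
  move=> i /=; rewrite in_itv/= mxE.
  by have /andP[-> /ltW ->] := reduce_angle_itv (x ord0 i).
have y'x' i : `|y' ord0 i - x' ord0 i| <= pi.
  have /andP[] := floor_itv ((y ord0 i - x' ord0 i + pi) / (2 * pi)).
  rewrite -/(s i) ler_pdivlMr// ltr_pdivrMr// intrD [y' _ _]mxE => h1 h2.
  by rewrite ler_norml; apply/andP; split; lra.
have cosxy i : cos (x ord0 i - y ord0 i) = cos (y' ord0 i - x' ord0 i).
  rewrite -cosN opprB !mxE /reduce_angle.
  set a := Num.floor _.
  rewrite -(cosD2intpi (a - s i)) intrB; congr cos; ring.
have sum_ge0 : 0 <= \sum_(i < n) (1 - cos (x ord0 i - y ord0 i)).
  by apply: sumr_ge0 => i _; rewrite subr_ge0 cos_le1.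
rewrite -/(F x) -/(F y) -Fx -Fy.
have [close|] := pselect (forall i, `|y' ord0 i - x' ord0 i| < d).
  rewrite (le_trans (Fd _ Kx' _ close))// lerDl mulr_ge0// divr_ge0//.
  by rewrite mulr_ge0.
move/existsNP => [i /negP]; rewrite -leNgt => far.
apply: (@le_trans _ _ (2 * M)).
  apply: (le_trans (ler_normB _ _)); rewrite /F.
  by have := fM (to_torus x'); have := fM (to_torus y'); lra.
apply: (@le_trans _ _ (2 * M / (1 - cos d) *
    \sum_(i < n) (1 - cos (x ord0 i - y ord0 i)))); last first.
  by rewrite lerDr ltW.
(* The far coordinate [i] alone suffices: the other summands are nonnegative and cosine decreases on
   [[0, pi]]. *)
rewrite -mulrA ler_peMr ?mulr_ge0// mulrC ler_pdivlMr// mul1r (bigD1 i)//=.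
rewrite cosxy -(cos_norm (_ - _)) ler_wpDr//.
  by apply: sumr_ge0 => j _; rewrite subr_ge0 cos_le1.
rewrite lerB// leNgt ltr_cos ?in_itv/= ?normr_ge0 ?y'x' ?(ltW d0) ?(ltW dpi)//.
by rewrite -leNgt.
Unshelve. all: by end_near. Qed.

End row.
End angles.

(** * Measurability *)

Section borel_rows.
Context {R : realType}.

Definition rational_box n (b : 'rV[rat]_n * nat) : set 'rV[R]_n :=
  [set v | forall i, ball (ratr (b.1 ord0 i) : R) b.2.+1%:R^-1 (v ord0 i)].

Lemma measurable_rational_box n (b : 'rV[rat]_n * nat) :
  measurable (rational_box b).
Proof.
rewrite (_ : rational_box b = \big[setI/setT]_(i < n)
    ((fun v : 'rV[R]_n => v ord0 i) @^-1`
     ball (ratr (b.1 ord0 i) : R) b.2.+1%:R^-1)).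
  apply: bigsetI_measurable => i _.
  rewrite -[X in measurable X]setTI; apply: measurable_coord => //.
  exact: measurable_ball.
rewrite -bigcap_seq; apply/seteqP; split => v /= vb i.
  by move=> _; exact: vb.
by apply: vb; rewrite /= mem_index_enum.
Qed.

Lemma rational_box_basis n (x : 'rV[R]_n) (A : set 'rV[R]_n) : nbhs x A ->
  exists2 b, rational_box b x & rational_box b `<=` A.
Proof.
move=> /nbhs_ballP[r /= r0 xrA].
(* Two radii [1 / (m + 1)] must fit into [r], as the box is centred at a rational point near [x]. *)
pose m := Num.truncn (2 / r).
have m0 : 0 < m.+1%:R^-1 :> R by rewrite invr_gt0.
have mr : m.+1%:R^-1 + m.+1%:R^-1 < r.
  rewrite (_ : _ + _ = 2 / m.+1%:R); last by ring.
  by rewrite ltr_pdivrMr// -ltr_pdivrMl// mulrC truncnS_gt.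
have xq i : exists q : rat, ball (ratr q : R) m.+1%:R^-1 (x ord0 i).
  have [|q] := @rat_in_itvoo R (x ord0 i - m.+1%:R^-1) (x ord0 i + m.+1%:R^-1).
    by rewrite ltrBlDr -addrA ltrDl addr_gt0.
  rewrite in_itv/= => /andP[xq qx]; exists q.
  by rewrite /ball/= ltr_norml ltrBrDr addrC xq ltrBlDr addrC qx.
have [q qx] := choice xq.
exists (\row_i q i, m) => [i|y yb]; first by rewrite mxE.
apply: xrA; split=> // i j; rewrite ord1; apply: (le_ball (ltW mr)).
apply: (ball_triangle (ball_sym (qx j))).
by have := yb j; rewrite /= mxE.
Qed.

(** Products of rational boxes form a countable base, and each is measurable for the product
    sigma-algebra. Boxes not contained in [U] are replaced by the empty set, so the union runs over
    the whole countable index type. *)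
Lemma open_measurable_row2 n p (U : set ('rV[R]_n * 'rV[R]_p)) :
  open U -> measurable U.
Proof.
move=> oU.
pose B (b : ('rV[rat]_n * nat) * ('rV[rat]_p * nat)) :
    set ('rV[R]_n * 'rV[R]_p) :=
  if `[< rational_box b.1 `*` rational_box b.2 `<=` U >]
  then rational_box b.1 `*` rational_box b.2 else set0.
rewrite (_ : U = \bigcup_b B b).
  apply: countable_bigcupT_measurable => [|b]; first exact: countableP.
  rewrite /B; case: ifPn => _ //.
  by apply: measurableX; exact: measurable_rational_box.
apply/seteqP; split=> [[x y] Uxy|xy [b _]]; last first.
  by rewrite /B; case: ifPn => // /asboolP; exact.
have [[V W] /= [xV yW] VWU] : nbhs (x, y) U by exact: open_nbhs_nbhs.
have [b1 xb1 b1V] := rational_box_basis xV.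
have [b2 yb2 b2W] := rational_box_basis yW.
exists (b1, b2) => //; rewrite /B; case: ifPn => [_|/asboolP[]]; first by split.
by move=> [x' y'] [/b1V ? /b2W ?]; exact: VWU.
Qed.

Lemma open_measurable_row n (U : set 'rV[R]_n) : open U -> measurable U.
Proof.
(* Pairing with the one-point space of rows of length 0 reduces to the two-block case. *)
move=> oU; pose i (x : 'rV[R]_n) : 'rV[R]_n * 'rV[R]_0 := (x, 0).
have mi : measurable_fun setT i by apply: measurable_fun_pair.
rewrite (_ : U = i @^-1` (fst @^-1` U)) // -[X in measurable X]setTI.
apply: mi => //; apply: open_measurable_row2.
by apply: open_comp => // z _; exact: cvg_fst.
Qed.

Lemma continuous_measurable_row2 n p (D : set ('rV[R]_n * 'rV[R]_p))
    (g : 'rV[R]_n * 'rV[R]_p -> R) :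
  open D -> {in D, continuous g} -> measurable_fun D g.
Proof.
move=> oD cg; apply: (measurability (@RGenOInfty.G R)).
  exact: RGenOInfty.measurableE.
move=> _ [_ [a ->] <-]; apply: open_measurable_row2.
rewrite openE => z [Dz /=]; rewrite in_itv/= andbT => az.
apply: filterI; first exact: open_nbhs_nbhs.
have : g z @[z --> z] --> g z by apply: cg; rewrite inE.
by move/cvgr_gt => /(_ _ az); apply: filterS => y /= ay; rewrite in_itv/= andbT.
Qed.

Lemma continuous_measurable_row n (D : set 'rV[R]_n) (g : 'rV[R]_n -> R) :
  open D -> {in D, continuous g} -> measurable_fun D g.
Proof.
move=> oD cg; apply: (measurability (@RGenOInfty.G R)).
  exact: RGenOInfty.measurableE.
move=> _ [_ [a ->] <-]; apply: open_measurable_row.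
rewrite openE => z [Dz /=]; rewrite in_itv/= andbT => az.
apply: filterI; first exact: open_nbhs_nbhs.
have : g z @[z --> z] --> g z by apply: cg; rewrite inE.
by move/cvgr_gt => /(_ _ az); apply: filterS => y /= ay; rewrite in_itv/= andbT.
Qed.

(** The function factors through its periodic lift to the space of rows, which is continuous, and
    the measurable section [angles]. *)
Lemma continuous_torus_measurable n (f : torus R n -> R) :
  continuous f -> measurable_fun setT f.
Proof.
move=> cf; rewrite (_ : f = (f \o @to_torus R n) \o angles); last first.
  by apply/funext => t; rewrite /= anglesK.
apply: measurableT_comp; last exact: measurable_angles.
apply: (continuous_measurable_row (D := setT : set 'rV[R]_n)).
  exact: openT.
by move=> x _; apply: continuous_comp; [exact: continuous_to_torus|exact: cf].
Qed.

(* The difference quotients are measurable on the whole space only after [h] is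
   cut off outside [Omega]; inside, the cut-off is eventually invisible. *)
Lemma measurable_gradient n (Omega : set 'rV[R]_n) (h : 'rV[R]_n -> R) :
  open Omega -> (forall I, Omega I -> differentiable h I) ->
  forall i, measurable_fun Omega (fun I => gradient h I ord0 i).
Proof.
move=> oOmega dh i; have mOmega := open_measurable_row oOmega.
pose e : 'rV[R]_n := delta_mx ord0 i.
pose h0 := h \_ Omega.
have mh0 : measurable_fun setT h0.
  apply: (iffLR (measurable_restrictT _ mOmega)).
  apply: (continuous_measurable_row oOmega) => I.
  by rewrite inE => OI; apply/differentiable_continuous/dh.
pose q (m : nat) I := m.+1%:R * (h0 (I + m.+1%:R^-1 *: e) - h0 I).
apply: (measurable_fun_cvg (h := q)) => [m|I OI].
  apply: measurable_funTS; apply: measurable_funM => //.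
  apply: measurable_funB => //; apply: measurableT_comp => //.
  apply: measurable_fun_row => j; under eq_fun do rewrite mxE.
  by apply: measurable_funD => //; exact: measurable_coord.
have /cvg_ex[l ql] : derivable h I e := diff_derivable (dh _ OI).
rewrite mxE (_ : 'D_e h I = l); last exact: cvg_lim ql.
have hm : (fun m : nat => m.+1%:R^-1 : R) @ \oo --> 0^'.
  move=> A A0; have : \forall m \near \oo, m.+1%:R^-1 != 0 :> R -> A m.+1%:R^-1.
    exact: (@cvg_harmonic R _ A0).
  by apply: filterS => m; apply; rewrite invr_eq0 pnatr_eq0.
have := cvg_comp _ _ hm ql; apply: cvg_trans; apply: near_eq_cvg.
have Im : (fun m : nat => I + m.+1%:R^-1 *: e) @ \oo --> I.
  rewrite -[X in _ --> X]addr0 -(scale0r e).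
  by apply: cvgD; [exact: cvg_cst|apply: cvgZr_tmp; exact: cvg_harmonic].
near=> m; rewrite /= /q invrK /h0 !patchE !mem_set//; last first.
  by near: m; apply: Im; exact: open_nbhs_nbhs.
by rewrite [_ *: e + I]addrC.
Unshelve. all: by end_near. Qed.

End borel_rows.

(** * Integration on the torus *)

Section bounded_integrals.
Context d (T : measurableType d) (R : realType).

Lemma finite_measure_bounded_integrable (mu : {measure set T -> \bar R})
    (f : T -> R) (M : R) :
  (mu setT < +oo)%E -> measurable_fun setT f -> (forall x, `|f x| <= M) ->
  mu.-integrable setT (EFin \o f).
Proof.
move=> muT mf fM; apply: measurable_bounded_integrable => //.
exists M; split; first exact: num_real.
by move=> y My x _; exact: le_trans (fM x) (ltW My).
Qed.

(** The complement of [D] is null for the restricted measure, and on measurable subsets of [D] the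
    two measures agree. *)
Lemma integral_mrestr (mu : {measure set T -> \bar R}) (D : set T)
    (mD : measurable D) (f : T -> R) (M : R) :
  (mu D < +oo)%E -> measurable_fun setT f -> (forall x, `|f x| <= M) ->
  (\int[mrestr mu mD]_x (f x)%:E = \int[mu]_(x in D) (f x)%:E)%E.
Proof.
move=> muD mf fM.
have intf : (mrestr mu mD).-integrable setT (EFin \o f).
  apply: (finite_measure_bounded_integrable (M := M)) => //.
  by rewrite /= /mrestr setTI.
have mu0 : mrestr mu mD (~` D) = 0%E by rewrite /mrestr setICl measure0.
rewrite (negligible_integral (measurableC mD) measurableT intf mu0).
rewrite setTD setCK; apply: eq_measure_integral => A _ AD.
by rewrite /= /mrestr (setIidl AD).
Qed.

End bounded_integrals.

(** * Integrals of cosines over the circle and the torus *)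

Section torus_integral.
Context {R : realType}.

Lemma integral_circle (f : circle R -> R) (M : R) :
  measurable_fun setT f -> (forall c, `|f c| <= M) ->
  (\int[circle_measure]_c (f c)%:E =
   \int[lebesgue_measure]_(x in `[0%R, (2 * pi)%R[) (f (to_circle x))%:E)%E.
Proof.
(* [phi] is [to_circle] retyped on [measurableTypeR R], the domain of [lebesgue_measure]. *)
move=> mf fM; pose phi : measurableTypeR R -> circle R := @to_circle R.
have mphi : measurable_fun setT phi by move=> _ A mA; rewrite setTI.
have mI : measurable (`[0, 2 * pi[%classic : set (measurableTypeR R)).
  exact: measurable_itv.
have mfphi : measurable_fun setT (f \o phi) by exact: measurableT_comp.
have muI : (lebesgue_measure (`[0%R, (2 * pi)%R[%classic : set (measurableTypeR R))
    < +oo)%E.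
  by rewrite lebesgue_measure_itv/=; case: ifP => // _; rewrite -EFinB ltry.
rewrite -(integral_mrestr mI muI mfphi (fun x => fM (phi x))).
pose nu := mrestr lebesgue_measure mI.
have nuT : (nu setT < +oo)%E by rewrite /nu /mrestr setTI.
rewrite -[RHS](@integral_pushforward _ _ _ _ _ phi mphi nu setT (EFin \o f)) //.
- exact/measurable_EFinP.
- rewrite preimage_setT; apply: (finite_measure_bounded_integrable (M := M)) => //.
Qed.


Lemma norm_cos_le1 (x : R) : `|cos x| <= 1.
Proof. by rewrite ler_norml cos_geN1 cos_le1. Qed.

Lemma measurable_cos : measurable_fun setT (@cos R).
Proof. by apply: continuous_measurable_fun; exact: continuous_cos. Qed.

Lemma measurable_cos_angle (k phi : R) :
  measurable_fun setT (fun c : circle R => cos (k * angle c + phi)).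
Proof.
apply: (measurableT_comp measurable_cos); apply: measurable_funD => //.
by apply: measurable_funM => //; exact: measurable_angle.
Qed.

(** For integer [k] the reduced angle may be replaced by [x] itself; for [k <> 0] the antiderivative
    [sin (k x + phi) / k] takes equal values at 0 and [2 pi]. *)
Lemma integral_circle_cos (k : int) (phi : R) :
  (\int[circle_measure]_(c in setT) (cos (k%:~R * angle c + phi))%:E =
  ((k == 0)%:R * (2 * pi) * cos phi)%:E)%E.
Proof.
have twopi0 : 0 < 2 * pi :> R by rewrite mulr_gt0 ?pi_gt0.
rewrite (@integral_circle (fun c => cos (k%:~R * angle c + phi)) 1); first last.
- by move=> c; exact: norm_cos_le1.
- exact: measurable_cos_angle.
have cosE (x : R) :
    cos (k%:~R * angle (to_circle x) + phi) = cos (k%:~R * x + phi).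
  rewrite angle_to_circle /reduce_angle.
  rewrite -[RHS](cosD2intpi (- (k * Num.floor (x / (2 * pi))))).
  by rewrite intrN intrM; congr cos; ring.
under eq_integral do rewrite cosE.
have [->|k0] := eqVneq k 0.
  under eq_integral do rewrite mul0r add0r.
  rewrite integral_cst//= lebesgue_measure_itv/= lte_fin twopi0 mul1r.
  by rewrite -EFinB subr0 -EFinM mulrC.
have kR0 : k%:~R != 0 :> R by rewrite intr_eq0.
pose F (x : R) := sin (k%:~R * x + phi) / k%:~R.
have dF (x : R) : is_derive x 1 F (cos (k%:~R * x + phi)).
  rewrite /F; apply: is_derive_eq; rewrite /GRing.scale/=.
  by field.
have cF : continuous F.
  by move=> x; apply/differentiable_continuous/derivable1_diffP.
(* Adding the endpoint [2 pi] leaves the integral unchanged and gives the closed interval that the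
   fundamental theorem requires. *)
rewrite mul0r mul0r integral_itv_bndo_bndc; last first.
  apply/measurable_EFinP/measurable_funTS.
  by apply: (measurableT_comp measurable_cos); apply: measurable_funD.
rewrite (@continuous_FTC2 _ _ F)//.
- rewrite /F -EFinB mulr0 add0r; congr EFin.
  have [+ _] := sin_cosDintpi (2 * k) phi.
  rewrite intrM (_ : phi + _ = k%:~R * (2 * pi) + phi); last by ring.
  move=> ->; rewrite abszM exprM sqrrN !expr1n mul1r; exact: subrr.
- apply: continuous_subspaceT => x; apply: continuous_comp.
    apply: cvgD; last exact: cvg_cst.
    by apply: cvgM; [exact: cvg_cst|exact: cvg_id].
  exact: continuous_cos.
- split=> [x _| |]; first exact: ex_derive.
  + exact/cvg_at_right_filter/cF.
  + exact/cvg_at_left_filter/cF.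
- by move=> x _; rewrite derive1E; apply: derive_val.
Qed.

End torus_integral.

Section torus_integral_cos.
Context {R : realType}.

Lemma lebesgue_torus_fin n : (@lebesgue_torus R n setT < +oo)%E.
Proof. by rewrite lebesgue_torusT ltry. Qed.

(** The torus measure is the image under [row_cons] of a product measure, so a change of variables
    and Fubini split off the first angle. *)
Lemma integral_torusS n (f : torus R n.+1 -> R) (M : R) :
  measurable_fun setT f -> (forall theta, `|f theta| <= M) ->
  (\int[@lebesgue_torus R n.+1]_theta (f theta)%:E =
   \int[circle_measure]_c
     \int[@lebesgue_torus R n]_theta (f (row_cons (c, theta)))%:E)%E.
Proof.
move=> mf fM; pose mu := (@circle_measure R \x @lebesgue_torus R n)%E.
have muT : (mu setT < +oo)%E.
  rewrite -setXTT.
  rewrite [X in (X < _)%E](product_measure1E _ _ measurableT measurableT).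
  rewrite [X in (X * _ < _)%E]circle_measureT.
  by rewrite [X in (_ * X < _)%E]lebesgue_torusT -EFinM ltry.
have mcons : measurable_fun setT (@row_cons _ (circle R) n).
  exact: measurable_row_cons.
have mfc : measurable_fun setT (f \o @row_cons _ (circle R) n).
  exact: measurableT_comp.
have intf : mu.-integrable setT (EFin \o (f \o @row_cons _ (circle R) n)).
  by apply: (finite_measure_bounded_integrable (M := M)) => // x; exact: fM.
have := integral12_prod_meas1 intf; rewrite /fubini_F /= => ->.
have -> := @eq_measure_integral _ _ _ setT
  (pushforward mu (@row_cons _ (circle R) n)) (@lebesgue_torus R n.+1)
  (EFin \o f).
  rewrite integral_pushforward//; exact/measurable_EFinP.
by [].
Qed.

Lemma measurable_cos_angles n (k : 'rV[int]_n) (phi : R) :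
  measurable_fun setT (fun theta => cos (pairing k (angles theta) + phi)).
Proof.
apply: (measurableT_comp (@measurable_cos R)); apply: measurable_funD => //.
apply: measurable_sum => i; apply: measurable_funM => //.
exact: (measurableT_comp (measurable_coord i) measurable_angles).
Qed.

(** Induction on [n] with arbitrary phase: the first coordinate is absorbed into the phase of the
    inner integral, which leaves a cosine integral over the circle. *)
Lemma integral_torus_cos n (k : 'rV[int]_n) (phi : R) :
  (\int[@lebesgue_torus R n]_theta (cos (pairing k (angles theta) + phi))%:E =
  ((k == 0)%:R * (2 * pi) ^+ n * cos phi)%:E)%E.
Proof.
elim: n k phi => [|n IH] k phi.
  rewrite [LHS]integral_dirac//; last first.
    by apply/measurable_EFinP; exact: measurable_cos_angles.
  rewrite diracT mul1e /pairing big_ord0 add0r expr0 mulr1.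
  by rewrite (_ : k == 0) ?mul1r//; apply/eqP/rowP => -[].
rewrite (@integral_torusS _ (fun theta => cos (pairing k (angles theta) + phi)) 1);
  first last.
- by move=> theta; exact: norm_cos_le1.
- exact: measurable_cos_angles.
pose k' : 'rV[int]_n := \row_i k ord0 (lift ord0 i).
have pairing_cons c theta :
    pairing k (angles (row_cons (c, theta))) + phi =
    pairing k' (angles theta) + ((k ord0 ord0)%:~R * angle c + phi).
  have anglesE i : angles (row_cons (c, theta)) ord0 i =
      angle (row_cons (c, theta) ord0 i) by rewrite mxE.
  rewrite /pairing big_ord_recl anglesE row_cons0 [RHS]addrA [X in X + _]addrC.
  congr (_ + _ + _); apply: eq_bigr => i _.
  by rewrite anglesE row_consS [RHS]mulrC !mxE mulrC.
under eq_integral do under eq_integral do rewrite pairing_cons.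
under eq_integral do rewrite IH.
have k0E : (k == 0) = (k' == 0) && (k ord0 ord0 == 0).
  apply/eqP/andP => [k0|[/eqP k'0 /eqP k0]].
    split; last by rewrite k0 mxE.
    by apply/eqP; apply/rowP => i; rewrite mxE k0 !mxE.
  apply/rowP => i; case: (unliftP ord0 i) => [j|] ->; rewrite mxE//.
  by move/rowP : k'0 => /(_ j); rewrite !mxE.
under eq_integral do rewrite EFinM.
rewrite integralZl//; last first.
  apply: (finite_measure_bounded_integrable (M := 1)) => //.
  - by rewrite [X in (X < _)%E]circle_measureT ltry.
  - exact: measurable_cos_angle.
  - by move=> c; exact: norm_cos_le1.
rewrite integral_circle_cos -EFinM k0E exprS -mulnb natrM; congr EFin; ring.
Qed.

End torus_integral_cos.

(** * Weyl equidistribution *)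

Section weyl.
Context {R : realType} {n : nat}.
Implicit Types (f : torus R n -> R) (P : 'rV[R]_n -> R) (w x : 'rV[R]_n).

Definition torus_mean f : R :=
  (2 * pi) ^- n * \int[@lebesgue_torus R n]_theta f theta.

Definition orbit_mean P w x (N : nat) : R :=
  N%:R^-1 * \sum_(1 <= j < N.+1) P (x + w *+ j).

Let volume_gt0 : 0 < (2 * pi) ^+ n :> R.
Proof. by rewrite exprn_gt0// mulr_gt0 ?pi_gt0. Qed.

Lemma torus_bounded_integrable f (M : R) :
  measurable_fun setT f -> (forall theta, `|f theta| <= M) ->
  (@lebesgue_torus R n).-integrable setT (EFin \o f).
Proof.
move=> mf fM; apply: (finite_measure_bounded_integrable (M := M)) => //.
exact: lebesgue_torus_fin.
Qed.

(** Measurability and a bound are carried through the induction because linearity of the torus mean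
    needs integrable summands. *)
Lemma trig_poly_equidistributed P w : trig_poly P ->
  (forall (k : 'rV[int]_n) (m : int), k != 0 -> pairing k w <> 2 * m%:~R * pi) ->
  [/\ measurable_fun setT (P \o angles), (exists B, forall x, `|P x| <= B) &
     forall x, orbit_mean P w x @ \oo --> torus_mean (P \o angles)].
Proof.
move=> + nres; elim=> [k phi|P1 P2 _ [m1 [B1 b1] l1] _ [m2 [B2 b2] l2]|
    c P1 _ [m1 [B1 b1] l1]].
- split; [exact: measurable_cos_angles|by exists 1 => x; exact: norm_cos_le1|].
  move=> x; rewrite /torus_mean /Rintegral integral_torus_cos /=.
  rewrite [X in _ --> X](_ : _ = (k == 0)%:R * cos phi); last first.
    by field; rewrite lt0r_neq0.
  (* Reindexing the times [1..N] from 0 moves one step [pairing k w] into the phase. *)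
  rewrite (_ : orbit_mean _ _ _ = fun N => N%:R^-1 *
     \sum_(j < N) cos (pairing k x + pairing k w + phi + j%:R * pairing k w));
     last first.
    apply/funext => N; rewrite /orbit_mean big_add1 big_mkord; congr (_ * _).
    apply: eq_bigr => j _; congr cos; rewrite pairingDr pairing_mulrn -natr1.
    by ring.
  have [->|k0] := eqVneq k 0; last first.
    by rewrite mul0r; apply: cesaro_cos_cvg0 => m; exact: nres.
  (* At frequency zero the average equals [cos phi] only for [N > 0]; at [N = 0] the empty sum gives
     0. *)
  rewrite mul1r; apply: cvg_near_cst; near=> N.
  under eq_bigr do rewrite !pairing0 mulr0 !addr0 add0r.
  rewrite big_const_ord iter_addr_0 -(mulr_natr (cos phi)) mulrCA mulVf ?mulr1//.
  by rewrite pnatr_eq0 -lt0n; near: N; exact: nbhs_infty_gt.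
- split.
  + exact: measurable_funD.
  + exists (B1 + B2) => x.
    by rewrite (le_trans (ler_normD _ _))// lerD.
  + move=> x; rewrite /torus_mean RintegralD//; last 2 first.
    * by apply: (torus_bounded_integrable (M := B1)) => // t; exact: b1.
    * by apply: (torus_bounded_integrable (M := B2)) => // t; exact: b2.
    rewrite mulrDr (_ : orbit_mean _ _ _ = orbit_mean P1 w x \+ orbit_mean P2 w x).
      by apply: cvgD; [exact: l1|exact: l2].
    by apply/funext => N; rewrite /orbit_mean /= big_split mulrDr.
- split.
  + exact: measurable_funM.
  + by exists (`|c| * B1) => x; rewrite normrM ler_wpM2l.
  + move=> x; rewrite /torus_mean RintegralZl//; last first.
      by apply: (torus_bounded_integrable (M := B1)) => // t; exact: b1.
    rewrite mulrCA (_ : orbit_mean _ _ _ = fun N => c * orbit_mean P1 w x N).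
      by apply: cvgM; [exact: cvg_cst|exact: l1].
    by apply/funext => N; rewrite /orbit_mean -mulr_sumr mulrCA.
Unshelve. all: by end_near. Qed.

(** Three errors of [e / 3]: replacing [f] by a trigonometric polynomial in the torus mean,
    replacing it along the orbit uniformly in [N > 0], and the convergence for the polynomial. *)
Lemma weyl_equidistribution f (M : R) w theta :
  continuous f -> (forall t, `|f t| <= M) ->
  (forall (k : 'rV[int]_n) (m : int), k != 0 -> pairing k w <> 2 * m%:~R * pi) ->
  (fun N : nat => N%:R^-1 * \sum_(1 <= j < N.+1) f (theta + to_torus (w *+ j)))
    @ \oo --> torus_mean f.
Proof.
move=> cf fM nres; have mf := continuous_torus_measurable cf.
set u := (fun N => _).
have -> : u = orbit_mean (f \o @to_torus R n) w (angles theta).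
  apply/funext => N; rewrite /u /orbit_mean; congr (_ * _).
  by apply: eq_bigr => j _; rewrite /= to_torusD anglesK.
apply/cvgrPdist_le => e e0; have e30 : 0 < e / 3 by rewrite divr_gt0.
have [P tP fP] := trig_poly_approx (torus_modulus cf fM) e30.
have [mP [B PB] /(_ (angles theta)) lP] := trig_poly_equidistributed tP nres.
have meanP : `|torus_mean f - torus_mean (P \o angles)| <= e / 3.
  have intf := torus_bounded_integrable mf fM.
  have intP := torus_bounded_integrable mP (fun t => PB (angles t)).
  have mfP : measurable_fun setT (fun t => f t - (P \o angles) t).
    exact: measurable_funB.
  have fPb t : `|f t - (P \o angles) t| <= e / 3.
    by have := fP (angles t); rewrite /= anglesK.
  have intfP := torus_bounded_integrable mfP fPb.
  rewrite /torus_mean -mulrBr -RintegralB// normrM gtr0_norm ?invr_gt0//.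
  rewrite ler_pdivrMl//; apply: (le_trans (le_normr_Rintegral _ intfP)) => //.
  apply: (@le_trans _ _ (\int[@lebesgue_torus R n]_t (e / 3))).
    apply: le_Rintegral => //.
    - exact: integrable_norm intfP.
    - by apply: (torus_bounded_integrable (M := `|e / 3|)) => //.
  by rewrite Rintegral_cst// [X in fine X]lebesgue_torusT /= mulrC.
near=> N.
have N0 : 0 < N%:R :> R by rewrite ltr0n; near: N; exact: nbhs_infty_gt.
have orbP : `|orbit_mean P w (angles theta) N -
    orbit_mean (f \o @to_torus R n) w (angles theta) N| <= e / 3.
  rewrite /orbit_mean -mulrBr -sumrB normrM gtr0_norm ?invr_gt0//.
  rewrite ler_pdivrMl//; apply: (le_trans (ler_norm_sum _ _ _)).
  apply: (@le_trans _ _ (\sum_(1 <= j < N.+1) (e / 3))).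
    by apply: ler_sum => j _; rewrite distrC; exact: fP.
  by rewrite sumr_const_nat subn1 mulr_natl.
have limP :
    `|torus_mean (P \o angles) - orbit_mean P w (angles theta) N| <= e / 3.
  by near: N; move/cvgrPdist_le : lP; exact.
move: meanP orbP limP; rewrite !ler_norml => /andP[? ?] /andP[? ?] /andP[? ?].
by apply/andP; split; lra.
Unshelve. all: by end_near. Qed.

End weyl.

(** * Time averages of ensembles *)

Section ensemble_limit.
Context {R : realType} {n : nat}.
Implicit Types (Omega : set 'rV[R]_n) (omega : 'rV[R]_n -> 'rV[R]_n).
Implicit Types (g rho : 'rV[R]_n * torus R n -> R).

Lemma openX_setT (T : topologicalType) Omega : open Omega ->
  open (Omega `*` [set: T]).
Proof.
move=> oOmega; rewrite (_ : _ `*` _ = fst @^-1` Omega).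
  by apply: open_comp => // z _; exact: cvg_fst.
by apply/seteqP; split=> [z []|z] //=.
Qed.

Lemma continuous_slice (T U V : topologicalType) (f : T * U -> V) (x : T) :
  (forall y, {for (x, y), continuous f}) -> continuous (fun y => f (x, y)).
Proof.
move=> cf y; apply: (@continuous_comp _ _ _ (fun y => (x, y)) f); last exact: cf.
by apply: cvg_pair; [exact: cvg_cst|exact: cvg_id].
Qed.

(** Lifting the angles to rows makes [g] continuous on an open set of pairs of rows, hence
    measurable; the rotation enters through the measurable map [t] into that set. *)
Lemma measurable_fun_rotation_iter Omega omega g (j : nat) :
  open Omega -> (forall i, measurable_fun Omega (fun I => omega I ord0 i)) ->
  {in Omega `*` setT, continuous g} ->
  measurable_fun (Omega `*` setT) (fun p => g (rotation_iter omega j p)).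
Proof.
move=> oOmega momega cg; have mOmega := open_measurable_row oOmega.
pose lift_g (q : 'rV[R]_n * 'rV[R]_n) := g (q.1, to_torus q.2).
have oD : open (Omega `*` [set: 'rV[R]_n]) by exact: openX_setT.
have mlift : measurable_fun (Omega `*` [set: 'rV[R]_n]) lift_g.
  apply: (continuous_measurable_row2 oD) => q; rewrite inE => -[Oq _].
  apply: (@continuous_comp _ _ _ (fun q => (q.1, to_torus q.2)) g).
    apply: (@cvg_pair _ _ _ _ (nbhs q.1) (nbhs (to_torus q.2)));
      first exact: cvg_fst.
    by apply: continuous_comp; [exact: cvg_snd|exact: continuous_to_torus].
  by apply: cg; rewrite inE.
(* [omega] is measurable on [Omega] only; its extension by zero makes [t] measurable everywhere. *)
pose w I : 'rV[R]_n := \row_i ((fun I => omega I ord0 i) \_ Omega) I.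
have mw : measurable_fun setT w.
  apply: measurable_fun_row => i; under eq_fun do rewrite mxE.
  exact: (iffLR (measurable_restrictT _ mOmega)).
have wE I : Omega I -> w I = omega I.
  by move=> OI; apply/rowP => i; rewrite mxE patchE mem_set.
pose t (p : 'rV[R]_n * torus R n) : 'rV[R]_n * 'rV[R]_n :=
  (p.1, angles p.2 + w p.1 *+ j).
have mt : measurable_fun setT t.
  apply: measurable_fun_pair; first exact: measurable_fst.
  apply: measurable_fun_row => i.
  under eq_fun do rewrite mxE mulmxnE -mulr_natl.
  apply: measurable_funD.
    apply: (measurableT_comp (measurable_coord i)).
    by apply: (measurableT_comp measurable_angles); exact: measurable_snd.
  apply: measurable_funM => //; apply: (measurableT_comp (measurable_coord i)).
  by apply: (measurableT_comp mw); exact: measurable_fst.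
apply: (@eq_measurable_fun _ _ _ _ _ (lift_g \o t)).
  move=> p; rewrite inE => -[Op _] /=.
  by rewrite /lift_g /t /rotation_iter /= to_torusD anglesK wE.
apply: (measurable_comp _ _ mlift) => //.
- exact: open_measurable_row2.
- by move=> _ [p [Op _] <-].
- exact: measurable_funTS.
Qed.

Lemma Rintegral_sum_nat d (T : measurableType d)
    (mu : {measure set T -> \bar R}) (D : set T) (F : nat -> T -> R) (N : nat) :
  measurable D -> (forall j, mu.-integrable D (EFin \o F j)) ->
  mu.-integrable D (EFin \o (fun x => \sum_(1 <= j < N.+1) F j x)) /\
  \int[mu]_(x in D) (\sum_(1 <= j < N.+1) F j x) =
  \sum_(1 <= j < N.+1) \int[mu]_(x in D) F j x.
Proof.
move=> mD iF; elim: N => [|N [iN eN]].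
  rewrite big_geq//; under eq_fun do rewrite big_geq//.
  by split; [exact: integrable0|rewrite /Rintegral integral0].
rewrite big_nat_recr//= -eN.
under eq_fun do rewrite big_nat_recr//=.
split; last exact: RintegralD.
exact: (integrableD mD iN (iF N.+1)).
Qed.

Lemma time_average_cvg Omega omega g rho (M : R) :
  open Omega -> (forall i, measurable_fun Omega (fun I => omega I ord0 i)) ->
  {in Omega `*` setT, continuous g} ->
  (forall p, (Omega `*` setT) p -> `|g p| <= M) ->
  (forall p, (Omega `*` setT) p -> 0 <= rho p) ->
  lebesgue_phase.-integrable (Omega `*` setT) (EFin \o rho) ->
  (forall (k : 'rV[int]_n) (m : int) I, k != 0 -> Omega I ->
    pairing k (omega I) <> 2 * m%:~R * pi) ->
  (fun N : nat => N%:R^-1 * \sum_(1 <= j < N.+1)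
     \int[lebesgue_phase]_(p in Omega `*` setT)
       (g (rotation_iter omega j p) * rho p)) @ \oo -->
  \int[lebesgue_phase]_(p in Omega `*` setT)
     (torus_mean (fun theta => g (p.1, theta)) * rho p).
Proof.
move=> oOmega momega cg gM rho0 irho nres.
set D := Omega `*` setT.
have mD : measurable D by apply: measurableX => //; exact: open_measurable_row.
have mrho : measurable_fun D rho.
  by move/integrableP : irho => [/measurable_EFinP].
pose F j p := g (rotation_iter omega j p) * rho p.
have mF j : measurable_fun D (F j).
  by apply: measurable_funM => //; exact: measurable_fun_rotation_iter.
have DF j p : D p -> `|F j p| <= M * rho p.
  move=> [Op _]; rewrite /F normrM [`|rho p|]ger0_norm ?rho0//.
  by rewrite ler_wpM2r ?rho0// gM.
have iMrho : lebesgue_phase.-integrable D (EFin \o (fun p => M * rho p)).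
  exact: (integrableZl mD M irho).
have iF j : lebesgue_phase.-integrable D (EFin \o F j).
  apply: le_integrable iMrho => //; first exact/measurable_EFinP.
  by move=> p Dp /=; rewrite lee_fin (le_trans (DF j p Dp))// ler_norm.
pose A (N : nat) p := N%:R^-1 * \sum_(1 <= j < N.+1) F j p.
pose L p := torus_mean (fun theta => g (p.1, theta)) * rho p.
have mA N : measurable_fun D (A N).
  apply: measurable_funM => //; have [+ _] := Rintegral_sum_nat N mD iF.
  by move/integrableP => [/measurable_EFinP].
have AL p : D p -> A ^~ p @ \oo --> L p.
  move=> [Op _]; rewrite (_ : A ^~ p = fun N : nat => (N%:R^-1 *
    \sum_(1 <= j < N.+1) g (p.1, p.2 + to_torus (omega p.1 *+ j))) * rho p).
    apply: cvgM; last exact: cvg_cst.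
    apply: (@weyl_equidistribution _ _ (fun theta => g (p.1, theta)) M).
    - by apply: continuous_slice => theta; apply: cg; rewrite inE.
    - by move=> theta; exact: gM.
    - by move=> k m k0; exact: nres.
  by apply/funext => N; rewrite /A -mulrA mulr_suml.
(* The fibrewise torus mean inherits measurability as the pointwise limit of the time averages. *)
have mL : measurable_fun D L by exact: measurable_fun_cvg mA AL.
have AM N p : D p -> `|A N p| <= M * rho p.
  move=> Dp; have M0 : 0 <= M * rho p by exact: le_trans (DF 0%N p Dp).
  rewrite /A normrM ger0_norm ?invr_ge0//.
  (* At [N = 0] the default inverse of 0 makes the average vanish. *)
  have [->|N0] := eqVneq N 0%N; first by rewrite invr0 mul0r.
  rewrite ler_pdivrMl ?ltr0n ?lt0n//; apply: (le_trans (ler_norm_sum _ _ _)).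
  apply: (@le_trans _ _ (\sum_(1 <= j < N.+1) M * rho p)).
    by apply: ler_sum => j _; exact: DF.
  by rewrite sumr_const_nat subn1 mulr_natl.
have [iL _ intAL] : [/\ lebesgue_phase.-integrable D (EFin \o L),
    [sequence \int[lebesgue_phase]_(p in D) `|(EFin \o A N) p - (EFin \o L) p|]_N
      @ \oo --> 0 &
    [sequence \int[lebesgue_phase]_(p in D) (EFin \o A N) p]_N @ \oo -->
      \int[lebesgue_phase]_(p in D) (EFin \o L) p]%E.
  apply: (@dominated_convergence _ _ _ _ _ mD (fun N => EFin \o A N) (EFin \o L)
    (EFin \o (fun p => M * rho p))) => //.
  - by move=> N; exact/measurable_EFinP.
  - exact/measurable_EFinP.
  - by apply: aeW => p Dp; apply/fine_cvgP; split;
      [by apply: nearW|exact: AL].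
  - by apply: aeW => p N Dp; rewrite /= lee_fin AM.
have intL : (\int[lebesgue_phase]_(p in D) (EFin \o L) p)%E \is a fin_num.
  exact: integrable_fin_num.
(* Finiteness of the limit brings the convergence back from the extended reals to [R]. *)
rewrite -(fineK intL) in intAL.
rewrite (_ : (fun N : nat => _) = fun N => \int[lebesgue_phase]_(p in D) A N p).
  exact: fine_cvg intAL.
apply/funext => N; have [isum <-] := Rintegral_sum_nat N mD iF.
by rewrite -RintegralZl.
Qed.


End ensemble_limit.

(** * Complex components *)

Section complex_components.
Context {R : realType}.
Local Notation C := (R[i]^o).

Lemma normc_ReIm (z : C) : `|z| <= (`|complex.Re z| + `|complex.Im z|)%:C.
Proof.
rewrite normc_def lecR -[leRHS]ger0_norm ?addr_ge0// -sqrtr_sqr ler_wsqrtr//.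
by rewrite sqrrD !real_normK ?num_real// lerD2r lerDl mulrn_wge0// mulr_ge0.
Qed.

Lemma normr_Re_le (z : C) (M : R) : `|z| <= M%:C -> `|complex.Re z| <= M.
Proof. by move=> zM; rewrite -lecR; apply: le_trans zM; exact: normc_ge_Re. Qed.

Lemma normc_ge_Im (z : C) : `|complex.Im z|%:C <= `|z|.
Proof. by rewrite normc_def lecR -sqrtr_sqr ler_wsqrtr// lerDr sqr_ge0. Qed.

Lemma normr_Im_le (z : C) (M : R) : `|z| <= M%:C -> `|complex.Im z| <= M.
Proof. by move=> zM; rewrite -lecR; apply: le_trans zM; exact: normc_ge_Im. Qed.

Lemma cvg_complex (u : nat -> C) (l : C) :
  (fun k => complex.Re (u k)) @ \oo --> complex.Re l ->
  (fun k => complex.Im (u k)) @ \oo --> complex.Im l ->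
  u @ \oo --> l.
Proof.
move=> /cvgrPdist_lt uRe /cvgrPdist_lt uIm; apply/cvgrPdist_lt => -[e e'].
(* A positive complex number has zero imaginary part, so the tolerance is a positive real. *)
rewrite ltcE /= => /andP[/eqP-> e0].
have e20 : 0 < e / 2 by rewrite divr_gt0.
near=> k; apply: (le_lt_trans (normc_ReIm _)); rewrite ltcR (splitr e).
have -> : complex.Re (l - u k) = complex.Re l - complex.Re (u k).
  by case: (l) => ? ?; case: (u k).
have -> : complex.Im (l - u k) = complex.Im l - complex.Im (u k).
  by case: (l) => ? ?; case: (u k).
by apply: ltrD; near: k; [exact: uRe|exact: uIm].
Unshelve. all: by end_near. Qed.

Lemma nonexpansive_continuous (f : C -> R) :
  (forall z y, `|f z - f y|%:C <= `|z - y|) -> continuous f.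
Proof.
move=> f1 z A /nbhs_ballP[e /= e0 eA].
apply/nbhs_ballP; exists e%:C; first by rewrite /= ltcR.
by move=> y zy; apply: eA; rewrite /ball/= -ltcR; exact: le_lt_trans zy.
Qed.

Lemma continuous_Re : continuous (@complex.Re R : C -> R).
Proof.
apply: nonexpansive_continuous => z y.
have -> : complex.Re z - complex.Re y = complex.Re (z - y).
  by case: z => ? ?; case: y.
exact: normc_ge_Re.
Qed.

Lemma continuous_Im : continuous (@complex.Im R : C -> R).
Proof.
apply: nonexpansive_continuous => z y.
have -> : complex.Im z - complex.Im y = complex.Im (z - y).
  by case: z => ? ?; case: y.
exact: normc_ge_Im.
Qed.

Lemma ReZ (z : C) (a : R) : complex.Re (z * a%:C) = complex.Re z * a.
Proof. by case: z => x y /=; rewrite mulr0 subr0. Qed.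

Lemma ImZ (z : C) (a : R) : complex.Im (z * a%:C) = complex.Im z * a.
Proof. by case: z => x y /=; rewrite mulr0 add0r. Qed.

Lemma Re_sum (I : Type) (r : seq I) (F : I -> C) :
  complex.Re (\sum_(i <- r) F i) = \sum_(i <- r) complex.Re (F i).
Proof. exact: raddf_sum. Qed.

Lemma Im_sum (I : Type) (r : seq I) (F : I -> C) :
  complex.Im (\sum_(i <- r) F i) = \sum_(i <- r) complex.Im (F i).
Proof. exact: raddf_sum. Qed.

End complex_components.

(** * Convergence for complex observables, by real and imaginary parts *)

Theorem theorem3p1 (R : realType) (n : nat) (Omega : set 'rV[R]_n)
    (h : 'rV[R]_n -> R) (omega : 'rV[R]_n -> 'rV[R]_n)
    (G : 'rV[R]_n * torus R n -> R[i]^o)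
    (rho0 : 'rV[R]_n * torus R n -> R) :
  open Omega -> bounded_set Omega ->
  (forall I, Omega I -> differentiable h I /\ omega I = gradient h I) ->
  {within Omega `*` setT, continuous G} ->
  (exists M : R, forall p, (Omega `*` setT) p -> `|G p| <= M%:C) ->
  measurable_fun (Omega `*` setT) rho0 ->
  (forall p, (Omega `*` setT) p -> 0 <= rho0 p) ->
  (\int[lebesgue_phase]_(p in Omega `*` setT) (rho0 p)%:E = 1)%E ->
  lebesgue_phase.-integrable (Omega `*` setT) (fun p => (rho0 p ^+ 2)%:E) ->
  (forall (k : 'rV[int]_n) (m : int) (I : 'rV[R]_n), k != 0 -> Omega I ->
    \sum_(i < n) (k ord0 i)%:~R * omega I ord0 i <> 2 * m%:~R * pi) ->
  (fun N : nat => N%:R^-1 *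
     \sum_(1 <= j < N.+1) ensemble_average Omega omega rho0 j G : R[i]^o)
    @ \oo --> ensemble_average Omega omega rho0 0
                (fun p => angle_average G p.1).
Proof.
move=> oOmega _ dh cG [M GM] mrho rho_ge0 rho1 _ nres.
have oD : open (Omega `*` [set: torus R n]) by exact: openX_setT.
have mD : measurable (Omega `*` [set: torus R n]).
  by apply: measurableX => //; exact: open_measurable_row.
move: cG; rewrite continuous_open_subspace// => cG.
(* Nonnegativity and total mass 1 make [rho0] integrable, as the dominating function [M * rho0]
   requires. *)
have irho : lebesgue_phase.-integrable (Omega `*` setT) (EFin \o rho0).
  apply/integrableP; split; first exact/measurable_EFinP.
  rewrite (eq_integral (fun p => (rho0 p)%:E)) ?rho1 ?ltry// => p.
  by rewrite inE => Dp /=; rewrite ger0_norm// rho_ge0.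
have momega i : measurable_fun Omega (fun I => omega I ord0 i).
  apply: (@eq_measurable_fun _ _ _ _ _ (fun I => gradient h I ord0 i)).
    by move=> I; rewrite inE => /dh[_ ->].
  by apply: measurable_gradient => // I /dh[].
(* [pr] stands for the real or the imaginary part: both are continuous, do not increase the bound
   [M], and commute with sums, integrals and real scalars. *)
have component (pr : R[i]^o -> R) :
    (forall z a, pr (z * a%:C) = pr z * a) ->
    (forall r (F : nat -> R[i]^o),
      pr (\sum_(j <- r) F j) = \sum_(j <- r) pr (F j)) ->
    (forall d (T : measurableType d) (mu : {measure set T -> \bar R}) D f,
      pr (cintegral mu D f) = \int[mu]_(x in D) pr (f x)) ->
    continuous pr -> (forall z, `|z| <= M%:C -> `|pr z| <= M) ->
    (fun N : nat => pr (N%:R^-1 *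
       \sum_(1 <= j < N.+1) ensemble_average Omega omega rho0 j G)) @ \oo -->
    pr (ensemble_average Omega omega rho0 0 (fun p => angle_average G p.1)).
  move=> prZ pr_sum pr_int cpr prM.
  rewrite (_ : (fun N => _) = fun N : nat => N%:R^-1 * \sum_(1 <= j < N.+1)
      \int[lebesgue_phase]_(p in Omega `*` setT)
        (pr (G (rotation_iter omega j p)) * rho0 p)); last first.
    (* The complex factor [1 / N] is first recognised as a real scalar so that [prZ] can pull it
       out. *)
    apply/funext => N; rewrite mulrC -(rmorph_nat (real_complex R)) -fmorphV prZ.
    rewrite mulrC pr_sum; congr (_ * _); apply: eq_bigr => j _ /=.
    by rewrite /ensemble_average pr_int; apply: eq_Rintegral => p _; rewrite prZ.
  rewrite [X in _ --> X](_ : _ = \int[lebesgue_phase]_(p in Omega `*` setT)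
      (torus_mean (fun theta => pr (G (p.1, theta))) * rho0 p)); last first.
    rewrite /ensemble_average pr_int; apply: eq_Rintegral => p _.
    rewrite prZ; congr (_ * _).
    by rewrite /angle_average mulrC prZ mulrC pr_int.
  apply: (@time_average_cvg _ _ _ _ (fun p => pr (G p)) _ M) => //.
  - by move=> p Dp; apply: continuous_comp; [exact: cG|exact: cpr].
  - by move=> p Dp; apply/prM/GM.
apply: cvg_complex.
- apply: component; [exact: ReZ|exact: Re_sum|by []|exact: continuous_Re|].
  by move=> z; exact: normr_Re_le.
- apply: component; [exact: ImZ|exact: Im_sum|by []|exact: continuous_Im|].
  by move=> z; exact: normr_Im_le.
Qed.
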